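(* Let $D$ be an oriented virtual knot diagram. If for each classical crossing $c$ of $D$ we have $\operatorname{Ind}(c)\neq 0$ or $\nabla J_n(D_c)\neq\pm\nabla J_n(D)$ for some $n\in\mathbb{N}$ (possibly depending on $c$), then $D$ does not admit a cosmetic crossing change.
   Context: $\mathbb{N}$ denotes the positive integers. A virtual knot diagram is a one-component planar knot diagram whose double points are either classical crossings (with over/under information) or virtual crossings. An oriented virtual knot is an equivalence class of oriented virtual knot diagrams under planar isotopy, the classical Reidemeister moves RI, RII, RIII, the virtual Reidemeister moves VRI, VRII, VRIII (the same moves with all crossings virtual), and the semi-virtual move SV (an arc with two consecutive virtual crossings is moved past a classical crossing). $C(D)$ is the set of classical crossings of $D$. Cosmetic: a crossing change at a classical crossing $c$ of $D$ (switching over and under at $c$) is cosmetic if the resulting oriented diagram $D'$ is equivalent, as an oriented virtual knot diagram, to $D$. Sign: draw a classical crossing $c$ with both strands oriented upward. Then $\operatorname{sgn}(c)=+1$ if the over-strand goes from bottom left to top right, and $\operatorname{sgn}(c)=-1$ if the over-strand goes from bottom right to top left. Index: an arc is an edge of $D$ between two consecutive classical crossings along the orientation. Label all arcs by integers so that labels are unchanged at virtual crossings and, at each classical crossing drawn with both strands oriented upward (whatever its sign), if the incoming arc on the left (bottom left) has label $a$ and the incoming arc on the right (bottom right) has label $b$, then the outgoing arc at top left has label $b+1$ and the outgoing arc at top right has label $a-1$. Such a labeling always exists: for example, label an arc $\alpha$ by $\lambda(\alpha)=\sum_{c\in O(\alpha)}\operatorname{sgn}(c)$, where $O(\alpha)$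 is the set of classical crossings first met as overcrossings when traveling along the orientation starting from $\alpha$. Then $\operatorname{Ind}(c)=\operatorname{sgn}(c)(a-b-1)$. Dwrithe: for $n\in\mathbb{Z}\setminus\{0\}$, the $n$-th writhe is $J_n(D)=\sum_{c\in C(D),\,\operatorname{Ind}(c)=n}\operatorname{sgn}(c)$. For $n\in\mathbb{N}$ the $n$-th dwrithe is $\nabla J_n(D)=J_n(D)-J_{-n}(D)$. Smoothing against orientation: for $c\in C(D)$, $D_c$ is the oriented virtual knot diagram obtained by deleting $c$ and reconnecting so that (with both strands at $c$ oriented upward) the two top ends are joined to each other and the two bottom ends are joined to each other. The result is a one-component diagram, oriented as follows: the path of $D$ that leaves $c$ along the over-strand and returns to $c$ along the under-strand keeps its orientation, and the path that leaves $c$ along the under-strand and returns along the over-strand has its orientation reversed. *)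

(* Defs.v *)
From HB Require Import structures.
From mathcomp Require Import all_boot all_order all_algebra.
From mathcomp Require Import zify.
From Stdlib Require Import Relation_Operators.

Set Implicit Arguments.
Unset Strict Implicit.
Unset Printing Implicit Defensive.

Import GRing.Theory.

(** A virtual knot diagram is a 4-valent map in the plane which is the image of
    a single oriented closed curve.  It is recorded by the cyclic word of all
    passages of the curve through its double points, classical _and virtual_,
    each carrying the local orientation of the crossing.  Such a word
    determines a cellular decomposition of a closed oriented surface, and
    planarity is the statement that its Euler characteristic is 2. *)

Inductive level := Over | Under | Virtual.

Definition level_code (l : level) : option bool :=
  match l with Over => Some true | Under => Some false | Virtual => None end.
Definition level_decode (o : option bool) : level :=
  match o with Some true => Over | Some false => Under | None => Virtual end.
Lemma level_codeK : cancel level_code level_decode. Proof. by case. Qed.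
HB.instance Definition _ := Equality.copy level (can_type level_codeK).

Definition other_level (l : level) : level :=
  match l with Over => Under | Under => Over | Virtual => Virtual end.

(** [(c, l, b)]: the curve passes through the double point [c] at level [l], and
    [b = true] iff the other strand at [c] crosses it from its left to its
    right.  So, with both strands drawn upward, [b = false] is the strand from
    bottom left to top right and [b = true] the one from bottom right to top
    left. *)
Definition visit : Type := (nat * level * bool)%type.

Definition xing (v : visit) : nat := v.1.1.
Definition lev (v : visit) : level := v.1.2.
Definition from_left (v : visit) : bool := v.2.

Definition mate (v : visit) : visit :=
  (xing v, other_level (lev v), ~~ from_left v).

Definition code := seq visit.

Definition wf (w : code) : bool :=
  all (fun v => perm_eq [seq u <- w | xing u == xing v] [:: v; mate v]) w.

(** Edge [i] of [w] runs from visit [i] to visit [i + 1], cyclically; the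
    diagram without double points has one edge, numbered 0. *)
Definition in_edge (w : code) (i : nat) : nat :=
  if i is j.+1 then j else (size w).-1.

Definition visit0 : visit := (0, Virtual, false).

(** A dart [(e, fwd)] is the edge [e] travelled along ([fwd = true]) or against
    the orientation of the curve.  [face_next] turns left at the end of the
    dart, so that its orbits are the faces, each lying to the left of its
    darts.  The number of edges of [w] is [m.+1] when [m = (size w).-1]. *)
Definition face_next (w : code) (m : nat) (d : 'I_m.+1 * bool) :
    'I_m.+1 * bool :=
  if w is [::] then d else
  let p := if d.2 then d.1.+1 %% size w else d.1 : nat in
  let v := nth visit0 w p in
  let q := index (mate v) w in
  if from_left v == d.2 then (inord (in_edge w q), false) else (inord q, true).

(** V - E + F = 2 with V = size w / 2 and E = 2 V; the curve is connected. *)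
Definition planar (w : code) : bool :=
  fcard (@face_next w (size w).-1) predT == (size w)./2 + 2.

(** The outer (unbounded) face is the one to the left of the last edge of the
    word (the base edge, from the last visit back to the first) if
    [outer = true], and the one to its right if [outer = false]. *)
Record vdiagram := VDiagram {
  dcode :> code;
  outer : bool;
  _ : wf dcode && planar dcode }.

Definition rename (f : nat -> nat) (v : visit) : visit :=
  (f (xing v), lev v, from_left v).

(** The three strands of an RIII-type move, each given by its two consecutive
    visits in the order of the orientation.  [tri_side] tells on which side
    (true = left) of the strand through [v] the edge of the other strand at [v]
    lies; the three edges bound a face iff for each of them the two ends agree.
    *)
Definition tri_side (ps : seq (visit * visit)) (v : visit) : bool :=
  (mate v \in [seq p.1 | p <- ps]) (+) from_left v.

Definition triangle (ps : seq (visit * visit)) : bool :=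
  let vs := [seq p.1 | p <- ps] ++ [seq p.2 | p <- ps] in
  [&& all (fun v => mate v \in vs) vs,
      all (fun p => xing p.1 != xing p.2) ps &
      all (fun p => tri_side ps p.1 == tri_side ps p.2) ps].

Definition strand_at (l : level) (p : visit * visit) : bool :=
  (lev p.1 == l) && (lev p.2 == l).

(** RIII: a top and a bottom strand.  VRIII and SV: a strand all of whose
    crossings are virtual, the third crossing being virtual, resp. classical. *)
Definition slidable (ps : seq (visit * visit)) : bool :=
  (has (strand_at Over) ps && has (strand_at Under) ps)
  || has (strand_at Virtual) ps.

(** [move] is only used between planar codes, see [vequiv]: when both sides
    are planar, the rewriting is realized by the planar move in a disk.
    [Relabel] and [Rebase] (the base edge may be changed to any edge, and side
    of it, adjacent to the outer face) account for planar isotopy.  In the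
    other moves the base edge is not inside the disk of the move, so it
    marks the outer face before and after.  [RI] and [RII] include VRI and VRII
    (level [Virtual]).  In [RII] the directions at the two crossings are
    opposite, so that the two edges between them bound a bigon. *)
Inductive move : code * bool -> code * bool -> Prop :=
| Relabel (f : nat -> nat) w s :
    injective f -> move (w, s) (map (rename f) w, s)
| Rebase k w s s' :
    k < size w ->
    fconnect (@face_next w (size w).-1)
      (inord (size w).-1, s) (inord (in_edge w k), s') ->
    move (w, s) (rot k w, s')
| RI a b v s :
    move (a ++ b, s) (a ++ [:: v; mate v] ++ b, s)
| RII_parallel a b c x y l t s :
    let u := (x, l, t) in let v := (y, l, ~~ t) in
    move (a ++ b ++ c, s)
         (a ++ [:: u; v] ++ b ++ [:: mate u; mate v] ++ c, s)
| RII_antiparallel a b c x y l t s :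
    let u := (x, l, t) in let v := (y, l, ~~ t) in
    move (a ++ b ++ c, s)
         (a ++ [:: u; v] ++ b ++ [:: mate v; mate u] ++ c, s)
| RIII a b c d (p q r : visit * visit) s :
    triangle [:: p; q; r] -> slidable [:: p; q; r] ->
    move
      (a ++ [:: p.1; p.2] ++ b ++ [:: q.1; q.2] ++ c ++ [:: r.1; r.2] ++ d, s)
      (a ++ [:: p.2; p.1] ++ b ++ [:: q.2; q.1] ++ c ++ [:: r.2; r.1] ++ d, s).

Definition vequiv : vdiagram -> vdiagram -> Prop :=
  clos_refl_sym_trans vdiagram
    (fun D E => move (dcode D, outer D) (dcode E, outer E)).

Definition classical (w : code) : seq nat :=
  [seq xing v | v <- w & lev v == Over].

Definition switch (c : nat) (v : visit) : visit :=
  if xing v == c then (xing v, other_level (lev v), from_left v) else v.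

Lemma mateK : involutive mate.
Proof. by case=> [[c []] []]. Qed.

Lemma switchK c : involutive (switch c).
Proof.
case=> [[d l] b]; rewrite /switch /xing /=.
by case e: (d == c); rewrite /= e //; case: l.
Qed.

Lemma switch_inj c : injective (switch c).
Proof. exact: inv_inj (switchK c). Qed.

Lemma xing_switch c v : xing (switch c v) = xing v.
Proof. by rewrite /switch; case: ifP. Qed.

Lemma from_left_switch c v : from_left (switch c v) = from_left v.
Proof. by rewrite /switch; case: ifP. Qed.

Lemma mate_switch c v : mate (switch c v) = switch c (mate v).
Proof. by rewrite /switch [xing (mate v)]/=; case: ifP. Qed.

Lemma switch_wf c w : wf w -> wf (map (switch c) w).
Proof.
move=> /allP ww; apply/allP=> _ /mapP[v vw ->].
rewrite filter_map mate_switch xing_switch.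
rewrite (@eq_filter _ _ (fun u => xing u == xing v)) => [|u /=].
  exact: (perm_map (switch c) (ww v vw)).
by rewrite xing_switch.
Qed.

Lemma switch_face_next c w m :
  @face_next (map (switch c) w) m =1 @face_next w m.
Proof.
move=> d; rewrite /face_next /in_edge size_map.
have -> p : nth visit0 (map (switch c) w) p = switch c (nth visit0 w p).
  have {1}-> : visit0 = switch c visit0 by rewrite /switch; case: ifP.
  have [lt_p|le_p] := ltnP p (size w); first exact: nth_map.
  by rewrite !nth_default ?size_map.
by rewrite from_left_switch mate_switch (index_map (@switch_inj c)); case: w.
Qed.

Lemma switch_planar c w : planar w -> planar (map (switch c) w).
Proof.
by rewrite /planar size_map (eq_fcard (@switch_face_next c w _)).
Qed.

Lemma switch_ok c (D : vdiagram) :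
  wf (map (switch c) (dcode D)) && planar (map (switch c) (dcode D)).
Proof. by case: D => w s /= /andP[? ?]; rewrite switch_wf ?switch_planar. Qed.

Definition crossing_change (c : nat) (D : vdiagram) : vdiagram :=
  VDiagram (outer D) (switch_ok c D).

Definition cosmetic (D : vdiagram) (c : nat) : Prop :=
  vequiv (crossing_change c D) D.

Local Open Scope ring_scope.

Definition sgn (w : code) (c : nat) : int :=
  if (c, Over, false) \in w then 1 else -1.

(** Along the strand from bottom left to top right the label goes from [a] to
    [a - 1], along the other one from [b] to [b + 1]. *)
Definition jump (v : visit) : int :=
  if lev v == Virtual then 0 else if from_left v then 1 else -1.

(** [l i] is the label of edge [i].  The labels are carried by the edges between
    consecutive double points and are constant along the arcs. *)
Definition labeling (w : code) (l : nat -> int) : Prop :=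
  forall i, (i < size w)%N -> l i = l (in_edge w i) + jump (nth visit0 w i).

Definition left_visit (w : code) (c : nat) : nat :=
  find (fun v => (xing v == c) && ~~ from_left v) w.
Definition right_visit (w : code) (c : nat) : nat :=
  find (fun v => (xing v == c) && from_left v) w.

Definition ind_by (l : nat -> int) (w : code) (c : nat) : int :=
  sgn w c *
  (l (in_edge w (left_visit w c)) - l (in_edge w (right_visit w c)) - 1).

(** The labeling that starts with 0 on the base edge; by [arc_labelP] and
    [ind_byE] below the index may be computed from any labeling. *)
Definition arc_label (w : code) (i : nat) : int :=
  \sum_(v <- take i.+1 w) jump v.

Definition ind (w : code) (c : nat) : int := ind_by (arc_label w) w c.

Definition writhe (n : int) (w : code) : int :=
  \sum_(c <- classical w | ind w c == n) sgn w c.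

Definition dwrithe (n : nat) (w : code) : int :=
  writhe n%:Z w - writhe (- n%:Z) w.

(** Reversing exactly one of the two strands of a crossing exchanges the two
    directions of crossing; reversing both of them does not. *)
Definition flip_if_separated (other : code) (v : visit) : visit :=
  if mate v \in other then (xing v, lev v, ~~ from_left v) else v.

(** The word is read cyclically from the overpassage of [c]: [A] leads from it to the
    underpassage of [c] and keeps its orientation, the rest [B] is reversed. *)
Definition smoothing (c : nat) (w : code) : code :=
  let r := behead (rot (find (fun v => (xing v == c) && (lev v == Over)) w) w) in
  let k := find (fun v => xing v == c) r in
  let A := take k r in
  let B := drop k.+1 r in
  map (flip_if_separated B) A ++ rev (map (flip_if_separated A) B).

Lemma mate_neq v : mate v != v.
Proof. by case: v => [[c l] b]; rewrite /mate !xpair_eqE /= andbC; case: b. Qed.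

Lemma wf_count w v : wf w -> v \in w -> count_mem v w = 1%N.
Proof.
move=> /allP ww vw.
transitivity (count_mem v [seq u <- w | xing u == xing v]).
  by rewrite count_filter; apply: eq_count => u /=; case: eqP => // ->;
    rewrite eqxx.
by rewrite (permP (ww v vw)) /= eqxx (negbTE (mate_neq v)).
Qed.

Lemma wf_uniq w : wf w -> uniq w.
Proof.
move=> ww; apply: count_mem_uniq => v; have [|/count_memPn //] := boolP (v \in w).
by move/(wf_count ww).
Qed.

Lemma wf_mate w v : wf w -> (mate v \in w) = (v \in w).
Proof.
move=> /allP ww.
have cl u : u \in w -> mate u \in w.
  move=> /ww/perm_mem/(_ (mate u)); rewrite !inE eqxx orbT mem_filter.
  by case/andP.
by apply/idP/idP => /cl; rewrite ?mateK.
Qed.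

Lemma wf_xing w u v : wf w -> v \in w -> u \in w -> xing u = xing v ->
  u = v \/ u = mate v.
Proof.
move=> /allP ww /ww/perm_mem/(_ u) + uw e.
rewrite mem_filter e eqxx uw !inE => /esym/orP[]/eqP; by [left | right].
Qed.

Lemma jump_mate v : jump (mate v) = - jump v.
Proof. by case: v => [[c []] []]; rewrite /jump //= ?oppr0 ?opprK. Qed.

Lemma sum_jump w : wf w -> \sum_(v <- w) jump v = 0.
Proof.
move=> ww.
have pm : perm_eq (map mate w) w.
  apply: uniq_perm; rewrite ?(map_inj_uniq (inv_inj mateK)) ?wf_uniq // => v.
  by rewrite -[v]mateK (mem_map (inv_inj mateK)) mateK (wf_mate _ ww).
have : \sum_(v <- w) jump v = - \sum_(v <- w) jump v.
  rewrite -[LHS](perm_big _ pm) big_map -sumrN.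
  by apply: eq_bigr => v _; rewrite jump_mate.
by move: (\sum_(v <- w) jump v) => S; lia.
Qed.

Lemma arc_labelP w : wf w -> labeling w (arc_label w).
Proof.
move=> ww i lt_i; rewrite /arc_label (take_nth visit0) // -cats1 big_cat big_seq1.
congr (_ + _); case: i lt_i => [|i] // lt_0.
by rewrite take0 big_nil /= prednK // take_size sum_jump.
Qed.

Lemma ind_byE l w c :
  wf w -> labeling w l -> c \in classical w -> ind_by l w c = ind w c.
Proof.
move=> ww lP.
have lE i : (i < size w)%N -> l i - arc_label w i = l 0 - arc_label w 0.
  elim: i => // i IH lt_i; rewrite lP // arc_labelP //= -IH 1?ltnW //.
  by rewrite opprD addrACA subrr addr0.
have lE' i : (i < size w)%N ->
    l (in_edge w i) - arc_label w (in_edge w i) = l 0 - arc_label w 0.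
  by case: i => [|i] lt_i; apply: lE => /=; rewrite ?ltn_predL // ltnW.
move=> /mapP[v]; rewrite mem_filter => /andP[_ vw] ->.
have side b : has (fun u => (xing u == xing v) && (from_left u == b)) w.
  have [e|e] := eqVneq (from_left v) b.
    by apply/hasP; exists v; rewrite // eqxx e eqxx.
  apply/hasP; exists (mate v); first by rewrite wf_mate.
  by rewrite eqxx /=; move: e; case: (from_left v) b => [] [].
have L : (left_visit w (xing v) < size w)%N.
  rewrite -has_find; apply: sub_has (side false) => u /andP[-> /eqP h].
  by rewrite h.
have R : (right_visit w (xing v) < size w)%N.
  rewrite -has_find; apply: sub_has (side true) => u /andP[-> /eqP h].
  by rewrite h.
rewrite /ind /ind_by; congr (_ * (_ - 1)).
by have := lE' _ L; have := lE' _ R; lia.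
Qed.

Lemma wf_perm w w' : perm_eq w w' -> wf w -> wf w'.
Proof.
move=> pw /allP ww; apply/allP=> v; rewrite -(perm_mem pw) => vw.
by rewrite -(permPl (perm_filter _ pw)) ww.
Qed.

Lemma smoothing_wf w c : wf w -> c \in classical w -> wf (smoothing c w).
Proof.
move=> ww /mapP[v]; rewrite mem_filter => /andP[ov vw] ->; rewrite /smoothing.
set i := find _ w.
have lt_i : (i < size w)%N.
  by rewrite -has_find; apply/hasP; exists v; rewrite // eqxx.
have Di : nth visit0 w i = v.
  have hs : has (fun u => (xing u == xing v) && (lev u == Over)) w.
    by rewrite has_find.
  have /andP[/eqP e /eqP o] := nth_find visit0 hs.
  have [//|e'] := wf_xing ww vw (mem_nth visit0 lt_i) e.
  by move: o ov; rewrite e'; clear; case: v => [[? []] ?].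
rewrite /rot (drop_nth visit0 lt_i) Di /=; set r := drop i.+1 w ++ take i w.
have pr : perm_eq w (v :: r).
  have -> : w = take i w ++ v :: drop i.+1 w.
    by rewrite -Di -drop_nth // cat_take_drop.
  by rewrite perm_catC.
have wr := wf_perm pr ww.
have /andP[vr _] := wf_uniq wr.
set k := find _ r.
have mr : mate v \in r.
  by move: (wf_mate v wr); rewrite !inE eqxx (negbTE (mate_neq v)).
have hk : has (fun u => xing u == xing v) r.
  by apply/hasP; exists (mate v); rewrite // eqxx.
have lt_k : (k < size r)%N by rewrite -has_find.
have Dk : nth visit0 r k = mate v.
  have /eqP e := nth_find visit0 hk.
  have kr := mem_nth visit0 lt_k.
  have kvr : nth visit0 r k \in v :: r by rewrite inE kr orbT.
  have [e'|//] := wf_xing wr (mem_head v r) kvr e.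
  by move: vr; rewrite -e' kr.
have Dr : r = take k r ++ mate v :: drop k.+1 r.
  by rewrite -Dk -drop_nth // cat_take_drop.
move: (take k r) (drop k.+1 r) Dr => A B Dr.
have {}wr : wf (v :: mate v :: A ++ B).
  by apply: wf_perm wr; rewrite perm_cons Dr -cat_rcons -cats1 -catA perm_catCA.
have uAB := wf_uniq wr.
have xAB u : u \in A ++ B -> xing u != xing v.
  move=> uin; apply/eqP => e; move: uAB => /=; rewrite inE negb_or -!andbA.
  have uin' : u \in v :: mate v :: A ++ B by rewrite !inE uin !orbT.
  case/and4P => _ vn mn _; have [e'|e'] := wf_xing wr (mem_head _ _) uin' e.
    by rewrite -e' uin in vn.
  by rewrite -e' uin in mn.
have {wr} wAB : wf (A ++ B).
  apply/allP => u uin; have := allP wr u; rewrite !inE uin !orbT => /(_ isT) /=.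
  by rewrite [xing (mate v)]/= eq_sym (negbTE (xAB u uin)).
have {uAB xAB} := wf_uniq wAB; rewrite cat_uniq => /and3P[_ /hasPn dAB _].
pose g u := if u \in A then flip_if_separated B u else flip_if_separated A u.
have xg u : xing (g u) = xing u.
  by rewrite /g /flip_if_separated; do !case: ifP.
have gm u : u \in A ++ B -> g (mate u) = mate (g u).
  move=> uin; have := uin; rewrite -(wf_mate _ wAB) !mem_cat.
  have dB x : x \in B -> x \in A = false by move/dAB/negbTE.
  rewrite /g /flip_if_separated !mateK.
  move: uin; rewrite mem_cat.
  have [uA|uA] := boolP (u \in A); have [mA|mA] := boolP (mate u \in A) => //=.
  - have -> : u \in B = false by apply/negP => /dB; rewrite uA.
    have -> // : mate u \in B = false by apply/negP => /dB; rewrite mA.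
  - by move=> _ ->.
  - by move=> ->.
suff : wf (map g (A ++ B)).
  apply: wf_perm; rewrite map_cat.
  have -> : map g A = map (flip_if_separated B) A.
    by apply/eq_in_map => u uA; rewrite /g uA.
  have -> : map g B = map (flip_if_separated A) B.
    by apply/eq_in_map => u /dAB/negbTE uA; rewrite /g uA.
  by rewrite perm_cat2l perm_sym perm_rev.
apply/allP => _ /mapP[u uin ->].
rewrite filter_map -(gm u uin) xg.
rewrite (@eq_filter _ _ (fun x => xing x == xing u)) => [|x /=].
  exact: (perm_map g (allP wAB u uin)).
by rewrite xg.
Qed.

(* Main.v *)
Require Import Defs.
From mathcomp Require Import all_boot all_order all_algebra.
From mathcomp Require Import zify ring.

Set Implicit Arguments.
Unset Strict Implicit.
Unset Printing Implicit Defensive.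

Import GRing.Theory Num.Theory.
Local Open Scope ring_scope.

(** For a classical crossing [c] of a diagram [D], consider the pair
    (Ind(c), |dJ_n(D_c)|), where dJ_n is the n-th dwrithe.  The crossing change
    at [c] reverses the sign of [c], negates Ind(c), and alters neither the
    second component at [c] nor the signs and pairs of the other crossings.
    Hence it is enough to show that, for every function [f] with
    f(0, |dJ_n(D)|) = 0, the sum of sgn(c) f(Ind(c), |dJ_n(D_c)|) over all
    classical crossings is an invariant of oriented virtual knots
    ([same_vequiv]): a cosmetic crossing change at [c] then forces
    f(Ind(c), m) + f(- Ind(c), m) = 0 with m = |dJ_n(D_c)|
    ([crossing_sum_switch]).  If Ind(c) is not 0, this fails when [f] is the
    indicator of the single nonzero index Ind(c); if m differs from
    |dJ_n(D)|, it fails when [f] is the indicator of m in the second argument.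

    The invariance holds because the crossing of an RI move has the pair
    (0, |dJ_n(D)|), the two crossings of an RII move have the same pair and
    opposite signs, and an RIII-type move preserves all signs and pairs.  To
    prove this without following the positions of the passages in a word, a
    word is replaced by the relation [on_arc w v u], saying that [u] lies on
    the arc from [v] to [mate v].  This relation and the jumps determine
    indices and dwrithes ([ind_arcsum], [dsum_dwrithe]), and a smoothing acts on
    them by the Boolean formulas [smooth_e] and [smooth_j] ([dsum_smoothing]).
    The three kinds of moves become an isolated chord, a bigon and a
    triangle, and each of these patterns persists under the smoothing of any
    crossing outside it.  What remains is the smoothing of a crossing of the
    pattern itself: [dsmooth_at_isolated], [dsmooth_at_bigon] and
    [dsmooth_corner].

    Virtual crossings have jump 0 and contribute nothing, and the dwrithe of
    a reversed word is the opposite one, so that the choice of orientation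
    of the smoothed diagram is immaterial up to sign.  Neither planarity nor the
    outer face enters. *)

(** * Weighted chords and their smoothing *)

(** The weight [j v] stands for the jump of the labels at the passage [v],
    possibly after some smoothings; the jumps at the two passages of a crossing
    are opposite. *)
Definition alternating (j : visit -> int) : Prop :=
  forall v, j (mate v) = - j v.

(** [e v u] is read as: [u] lies on the arc from [v] to [mate v].  The arc of
    [mate v] is the complementary one.  The values with [xing u = xing v] are
    never used, so that complementing them as well is harmless. *)
Definition arc_rel (s : code) (e : rel visit) : Prop :=
  {in s, forall v u, e (mate v) u = ~~ e v u}.

Definition odd_fun (phi : int -> int) : Prop := forall i, phi (- i) = - phi i.

(** The sum of the weights on the open arc from [v] to [mate v].  For an
    overpassage it is the opposite of the index, see [ind_arcsum]. *)
Definition arcsum (s : code) (j : visit -> int) (e : rel visit) (v : visit) :=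
  \sum_(u <- s | xing u != xing v) (if e v u then j u else 0).

(** Both passages of a crossing contribute the same amount when [phi] is odd;
    for [phi = spike n] below this is twice the [n]-th dwrithe, see
    [dsum_dwrithe]. *)
Definition dsum (phi : int -> int) (s : code) (j : visit -> int)
    (e : rel visit) : int :=
  \sum_(v <- s) j v * phi (arcsum s j e v).

(** The word without the two passages of the crossing of [c]. *)
Definition others (c : visit) (s : code) : code :=
  [seq u <- s | xing u != xing c].

(** Let [A] be the arc from [c] to [mate c] and [B] the complementary one, so
    that the smoothed word is [A] followed by the reverse of [B].  The weights
    are negated at the crossings that have one passage on each of [A] and
    [B]. *)
Definition smooth_j (j : visit -> int) (e : rel visit) (c u : visit) : int :=
  if e c u (+) e c (mate u) then - j u else j u.

(** The arc of [v] in the smoothed word: it is unchanged if both ends lie on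
    [A], complemented if both lie on the reversed part [B], and complemented on
    [B] only if the two ends are separated. *)
Definition smooth_e (e : rel visit) (c v u : visit) : bool :=
  e v u (+) (~~ e c v && ~~ e c (mate v))
        (+) ((e c v (+) e c (mate v)) && ~~ e c u).

(** [dsum] after the smoothing at the crossing of [c]. *)
Definition dsmooth (phi : int -> int) (s : code) (j : visit -> int)
    (e : rel visit) (c : visit) : int :=
  dsum phi (others c s) (smooth_j j e c) (smooth_e e c).

Lemma xing_mate v : xing (mate v) = xing v. Proof. by []. Qed.

Lemma wf_split w v : wf w -> v \in w -> perm_eq w [:: v, mate v & others v w].
Proof.
move=> ww vw; have h := allP ww v vw.
rewrite -(perm_filterC (fun u => xing u == xing v) w).
by rewrite -[_ :: _ :: _]/([:: v; mate v] ++ _) perm_cat2r.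
Qed.

Lemma wf_cons_others s v :
  wf [:: v, mate v & s] -> {in s, forall u, xing u != xing v}.
Proof.
move=> ws u us; apply/eqP => e.
have := wf_uniq ws; rewrite /= inE negb_or -!andbA => /and4P[_ vs mvs _].
have us' : u \in [:: v, mate v & s] by rewrite !inE us !orbT.
by have [e'|e'] := wf_xing ws (mem_head _ _) us' e; rewrite -e' us in vs mvs.
Qed.

Lemma wf_others c w : wf w -> wf (others c w).
Proof.
move=> /allP ww; apply/allP => v; rewrite mem_filter => /andP[vc vw].
rewrite -filter_predI (@eq_filter _ _ (fun u => xing u == xing v)) ?ww // => u.
by rewrite /=; case: eqP => //= ->.
Qed.

Lemma others_id s v :
  {in s, forall u, xing u != xing v} -> others v s = s.
Proof. by move=> h; apply/all_filterP/allP. Qed.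

Lemma wf_behead2 s v : wf [:: v, mate v & s] -> wf s.
Proof.
move=> ws; have := wf_others v ws.
by rewrite /others /= xing_mate eqxx /= -/(others v s) others_id //;
   apply: wf_cons_others.
Qed.

Lemma sum_alternating w j : wf w -> alternating j -> \sum_(v <- w) j v = 0.
Proof.
move=> ww fj.
have pm : perm_eq (map mate w) w.
  apply: uniq_perm; rewrite ?(map_inj_uniq (inv_inj mateK)) ?wf_uniq // => v.
  by rewrite -[v]mateK (mem_map (inv_inj mateK)) mateK (wf_mate _ ww).
have : \sum_(v <- w) j v = - \sum_(v <- w) j v.
  rewrite -[LHS](perm_big _ pm) big_map -sumrN.
  by apply: eq_bigr => v _; rewrite fj.
by move: (\sum_(v <- w) j v) => S; lia.
Qed.

Lemma odd_fun0 phi : odd_fun phi -> phi 0 = 0.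
Proof. by move=> /(_ 0); rewrite oppr0; move: (phi 0) => a; lia. Qed.

Lemma perm_arcsum s s' j e v : perm_eq s s' -> arcsum s j e v = arcsum s' j e v.
Proof. exact: perm_big. Qed.

Lemma perm_dsum phi s s' j e : perm_eq s s' -> dsum phi s j e = dsum phi s' j e.
Proof.
move=> p; rewrite /dsum (perm_big _ p) /=.
by apply: eq_bigr => v _; rewrite (perm_arcsum j e v p).
Qed.

Lemma perm_dsmooth phi s s' j e c :
  perm_eq s s' -> dsmooth phi s j e c = dsmooth phi s' j e c.
Proof. by move=> p; apply: perm_dsum; apply: perm_filter. Qed.

Lemma eq_arcsum s j j' e e' v :
  {in s, forall u, xing u != xing v -> j u = j' u} ->
  {in s, forall u, xing u != xing v -> e v u = e' v u} ->
  arcsum s j e v = arcsum s j' e' v.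
Proof.
move=> hj he; rewrite /arcsum big_seq_cond [RHS]big_seq_cond;
  apply: eq_bigr => u /andP[us uv].
by rewrite hj // he.
Qed.

Lemma eq_dsum phi s j j' e e' :
  {in s, forall u, j u = j' u} ->
  {in s, forall v, j v = 0 \/ arcsum s j e v = arcsum s j' e' v} ->
  dsum phi s j e = dsum phi s j' e'.
Proof.
move=> hj he; apply: eq_big_seq => v vs; rewrite -hj //.
by have [->|->] := he v vs; rewrite ?mul0r.
Qed.

Lemma arcsum_mate s j e v :
  wf s -> alternating j -> arc_rel s e -> v \in s ->
  arcsum s j e (mate v) = - arcsum s j e v.
Proof.
move=> ws fj he vs.
have h0 : \sum_(u <- s | xing u != xing v) j u = 0.
  by rewrite -big_filter (sum_alternating (wf_others v ws) fj).
apply/eqP; rewrite -addr_eq0 /arcsum xing_mate -big_split /=; apply/eqP.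
rewrite -[RHS]h0; apply: eq_bigr => u _; rewrite he //.
by case: (e v u); rewrite ?addr0 ?add0r.
Qed.

(** Complementing all arcs amounts to reversing the word. *)
Lemma dsum_compl phi s j e e' :
  wf s -> alternating j -> odd_fun phi ->
  {in s &, forall v u, xing u != xing v -> e' v u = ~~ e v u} ->
  dsum phi s j e' = - dsum phi s j e.
Proof.
move=> ws fj op he; rewrite /dsum -sumrN; apply: eq_big_seq => v vs.
suff -> : arcsum s j e' v = - arcsum s j e v by rewrite op mulrN.
have h0 : \sum_(u <- s | xing u != xing v) j u = 0.
  by rewrite -big_filter (sum_alternating (wf_others v ws) fj).
apply/eqP; rewrite -addr_eq0 /arcsum -big_split /=; apply/eqP.
rewrite -[RHS]h0 big_seq_cond [RHS]big_seq_cond.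
apply: eq_bigr => u /andP[us uv].
by rewrite he //; case: (e v u); rewrite ?addr0 ?add0r.
Qed.

Lemma arcsum_cons s j e v a :
  arcsum (a :: s) j e v =
  (if (xing a != xing v) && e v a then j a else 0) + arcsum s j e v.
Proof. by rewrite /arcsum big_cons; case: ifP => //= _; rewrite add0r. Qed.

Lemma dsum_pair phi s j e v :
  wf [:: v, mate v & s] -> alternating j -> odd_fun phi ->
  arc_rel [:: v, mate v & s] e ->
  dsum phi [:: v, mate v & s] j e =
  j v * phi (arcsum s j e v) *+ 2
  + \sum_(u <- s) j u * phi (arcsum [:: v, mate v & s] j e u).
Proof.
move=> ws fj op he; rewrite /dsum !big_cons addrA; congr (_ + _).
rewrite (arcsum_mate ws fj he (mem_head _ _)) fj op mulrNN mulr2n.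
by rewrite !arcsum_cons xing_mate eqxx !add0r.
Qed.

Lemma smooth_alternating j e c : alternating j -> alternating (smooth_j j e c).
Proof.
by move=> fj v; rewrite /smooth_j mateK addbC fj; case: ifP; rewrite ?opprK.
Qed.

Lemma smooth_arc s e c : arc_rel s e -> arc_rel (others c s) (smooth_e e c).
Proof.
move=> he v; rewrite mem_filter => /andP[_ vs] u; rewrite /smooth_e he // mateK.
by case: (e v u) (e c v) (e c (mate v)) (e c u) => [] [] [] [].
Qed.

(** The smoothings at the two passages of a crossing are reverses of each
    other. *)
Lemma dsmooth_mate phi s j e c :
  wf s -> alternating j -> odd_fun phi -> arc_rel s e -> c \in s ->
  dsmooth phi s j e (mate c) = - dsmooth phi s j e c.
Proof.
move=> ws fj op he cs; rewrite /dsmooth /others xing_mate -/(others c s).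
rewrite -(dsum_compl (e' := smooth_e e (mate c)) (wf_others c ws)) //;
  last first.
- move=> v u _ _ _; rewrite /smooth_e !he //.
  by case: (e v u) (e c v) (e c (mate v)) (e c u) => [] [] [] [].
- exact: smooth_alternating.
apply: eq_dsum => [u us|v vs].
  by rewrite /smooth_j !he // addNb addbN negbK.
right; apply: eq_arcsum => // u us _.
by rewrite /smooth_j !he // addNb addbN negbK.
Qed.

(** * Isolated chords: RI *)

Lemma arcsum_isolated_self s j e v b :
  wf [:: v, mate v & s] -> alternating j -> {in s, forall u, e v u = b} ->
  arcsum [:: v, mate v & s] j e v = 0.
Proof.
move=> ws fj hv; rewrite !arcsum_cons xing_mate eqxx /= !add0r.
rewrite /arcsum big_seq_cond.
under eq_bigr => u /andP[us _] do rewrite hv //.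
rewrite -big_seq_cond; case: b {hv}; last by rewrite big1.
rewrite -big_filter -/(others v s) others_id; last exact: wf_cons_others.
exact: sum_alternating (wf_behead2 ws) fj.
Qed.

Lemma arcsum_isolated s j e v u :
  alternating j -> e u v = e u (mate v) ->
  arcsum [:: v, mate v & s] j e u = arcsum s j e u.
Proof.
move=> fj hu; rewrite !arcsum_cons !xing_mate hu fj.
by case: ifP; rewrite addrA ?addrN add0r.
Qed.

(** The chord [v] is isolated: all other passages lie on the same side of it,
    and no other chord separates its ends. *)
Lemma dsum_isolated phi s j e v b :
  wf [:: v, mate v & s] -> alternating j -> odd_fun phi ->
  arc_rel [:: v, mate v & s] e ->
  {in s, forall u, e v u = b} -> {in s, forall u, e u v = e u (mate v)} ->
  dsum phi [:: v, mate v & s] j e = dsum phi s j e.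
Proof.
move=> ws fj op he hv hu; rewrite dsum_pair //.
have := arcsum_isolated_self ws fj hv.
rewrite !arcsum_cons xing_mate eqxx /= !add0r => ->.
rewrite odd_fun0 // mulr0 mul0rn add0r; apply: eq_big_seq => u us.
by rewrite arcsum_isolated ?hu.
Qed.

Lemma others_cons2 c v s : xing v != xing c ->
  others c [:: v, mate v & s] = [:: v, mate v & others c s].
Proof. by move=> vc; rewrite /others /= xing_mate vc. Qed.

Lemma others_cons2_id v s : wf [:: v, mate v & s] ->
  others v [:: v, mate v & s] = s.
Proof.
move=> ws; rewrite /others /= xing_mate eqxx /= -/(others v s).
by rewrite others_id //; apply: wf_cons_others.
Qed.

Lemma dsmooth_isolated phi s j e v b c :
  wf [:: v, mate v & s] -> alternating j -> odd_fun phi ->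
  arc_rel [:: v, mate v & s] e ->
  {in s, forall u, e v u = b} -> {in s, forall u, e u v = e u (mate v)} ->
  c \in s ->
  dsmooth phi [:: v, mate v & s] j e c = dsmooth phi s j e c.
Proof.
move=> ws fj op he hv hu cs; have vc := wf_cons_others ws cs.
have sc := smooth_arc (c := c) he.
have wc := wf_others c ws.
rewrite /dsmooth; rewrite eq_sym in vc.
move: sc wc; rewrite !others_cons2 // => sc wc.
apply: (dsum_isolated (b := b (+) ~~ e c v)) => //;
  first exact: smooth_alternating.
  move=> u; rewrite mem_filter => /andP[_ us].
  by rewrite /smooth_e hv // hu //; case: (e c (mate v)); rewrite ?addbF.
move=> u; rewrite mem_filter => /andP[_ us].
by rewrite /smooth_e !hu.
Qed.

(** Smoothing a kink leaves the diagram without the kink or its reverse,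
    according to the side [b]. *)
Lemma dsmooth_at_isolated phi s j e v b :
  wf [:: v, mate v & s] -> alternating j -> odd_fun phi ->
  arc_rel [:: v, mate v & s] e ->
  {in s, forall u, e v u = b} ->
  `|dsmooth phi [:: v, mate v & s] j e v| = `|dsum phi s j e|.
Proof.
move=> ws fj op he hv; rewrite /dsmooth others_cons2_id //.
have ws' := wf_behead2 ws.
have hv' u : u \in s -> e v (mate u) = b by rewrite -(wf_mate u ws'); apply: hv.
have hj : {in s, forall u, smooth_j j e v u = j u}.
  by move=> u us; rewrite /smooth_j hv // hv' // addbb.
have heb : {in s &, forall x u, smooth_e e v x u = e x u (+) ~~ b}.
  by move=> x u xs us; rewrite /smooth_e hv' // !hv // andbb addbb addbF.
rewrite (@eq_dsum _ _ _ j _ (fun x u => e x u (+) ~~ b)) //; last first.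
  by move=> x xs; right; apply: eq_arcsum => u us _; [exact: hj|exact: heb].
case: {heb hv hv'} b hj.
  move=> _; congr `|_|; apply: eq_dsum => // x xs; right.
  by apply: eq_arcsum => // u _ _; rewrite addbF.
move=> _; rewrite (@dsum_compl _ _ _ e) ?normrN // => x u _ _ _.
by rewrite addbT.
Qed.

(** * Bigons: RII *)

Lemma arcsum_others s j e v : {in s, forall u, xing u != xing v} ->
  arcsum s j e v = \sum_(u <- s) (if e v u then j u else 0).
Proof. by move=> h; rewrite /arcsum -big_filter -/(others v s) others_id. Qed.

(** The passages [u] and [v] are neighbours, and so are [mate u] and [mate v];
    the last two conditions fix the order of the four, for strands that run
    parallel as well as antiparallel. *)
Definition bigon (s : code) (j : visit -> int) (e : rel visit) (u v : visit) :=
  [/\ j v = - j u,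
      {in s, forall z, e z u = e z v /\ e z (mate u) = e z (mate v)},
      {in s, forall z, e u z = e v z},
      e v u = ~~ e u v & e v (mate u) = ~~ e u (mate v)].

Lemma arcsum_bigon s j e u v z :
  wf [:: u, mate u, v, mate v & s] -> alternating j -> bigon s j e u v ->
    z \in s ->
  arcsum [:: u, mate u, v, mate v & s] j e z = arcsum s j e z.
Proof.
move=> ws fj [jv ez _ _ _] zs; rewrite !arcsum_cons !xing_mate.
have [e3 e4] := ez z zs; rewrite e3 e4 !fj jv.
have -> : xing u != xing z.
  by rewrite eq_sym; apply: (wf_cons_others ws); rewrite !inE zs !orbT.
have -> : xing v != xing z.
  by rewrite eq_sym; apply: (wf_cons_others (wf_behead2 ws)).
move: (arcsum s j e z) (j u) => a b.
by case: (e z v); case: (e z (mate v)); rewrite /=; ring.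
Qed.

Lemma arcsum_bigon_sides s j e u v :
  wf [:: u, mate u, v, mate v & s] -> alternating j -> bigon s j e u v ->
  arcsum [:: u, mate u, v, mate v & s] j e v
  = arcsum [:: u, mate u, v, mate v & s] j e u.
Proof.
move=> ws fj [jv _ eu e1 e2]; have ws' := wf_behead2 ws.
have uv : xing v != xing u by apply: (wf_cons_others ws); rewrite mem_head.
rewrite !arcsum_cons !xing_mate !eqxx uv eq_sym uv /= e1 e2 !fj jv !add0r.
have -> : arcsum s j e v = arcsum s j e u.
  have sv := wf_cons_others ws'.
  have su z : z \in s -> xing z != xing u.
    by move=> zs; apply: (wf_cons_others ws); rewrite !inE zs !orbT.
  rewrite /arcsum big_seq_cond [RHS]big_seq_cond; apply: eq_big => z.
    by case zs: (z \in s); rewrite //= (sv _ zs) (su _ zs).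
  by case/andP => zs _; rewrite eu.
move: (arcsum s j e u) (j u) => a b.
by case: (e u v); case: (e u (mate v)); rewrite /=; ring.
Qed.

Lemma dsum_bigon phi s j e u v :
  wf [:: u, mate u, v, mate v & s] -> alternating j -> odd_fun phi ->
  arc_rel [:: u, mate u, v, mate v & s] e -> bigon s j e u v ->
  dsum phi [:: u, mate u, v, mate v & s] j e = dsum phi s j e.
Proof.
move=> ws fj op he b; have [jv _ _ _ _] := b.
set S := [:: u, mate u, v, mate v & s].
have uS : u \in S by rewrite mem_head.
have vS : v \in S by rewrite !inE eqxx !orbT.
rewrite /dsum !big_cons (arcsum_mate ws fj he uS) (arcsum_mate ws fj he vS).
rewrite (arcsum_bigon_sides ws fj b) !fj op jv.
under eq_big_seq => z zs do rewrite (arcsum_bigon ws fj b zs).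
move: (phi _) (\sum_(_ <- _) _) (j u) => a c d; ring.
Qed.

Lemma smooth_bigon s j e u v c :
  wf [:: u, mate u, v, mate v & s] -> c \in s ->
  bigon s j e u v -> bigon (others c s) (smooth_j j e c) (smooth_e e c) u v.
Proof.
move=> ws cs [jv ez eu e1 e2]; have [c1 c2] := ez c cs.
have ws' := wf_behead2 (wf_behead2 ws).
have [m1 m2] : e (mate c) u = e (mate c) v
    /\ e (mate c) (mate u) = e (mate c) (mate v).
  by apply: ez; rewrite wf_mate.
split.
- by rewrite /smooth_j jv c1 c2; case: ifP.
- move=> z; rewrite mem_filter => /andP[_ zs]; have [z1 z2] := ez z zs.
  by rewrite /smooth_e z1 z2 c1 c2.
- move=> z; rewrite mem_filter => /andP[_ zs].
  by rewrite /smooth_e eu // c1 c2.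
- by rewrite /smooth_e e1 c1 c2 -!addNb.
- by rewrite /smooth_e e2 c1 c2 -!addNb.
Qed.

Lemma dsmooth_bigon phi s j e u v c :
  wf [:: u, mate u, v, mate v & s] -> alternating j -> odd_fun phi ->
  arc_rel [:: u, mate u, v, mate v & s] e -> bigon s j e u v -> c \in s ->
  dsmooth phi [:: u, mate u, v, mate v & s] j e c = dsmooth phi s j e c.
Proof.
move=> ws fj op he b cs; have ws' := wf_behead2 ws.
have uc : xing u != xing c.
  by rewrite eq_sym; apply: (wf_cons_others ws); rewrite !inE cs !orbT.
have vc : xing v != xing c by rewrite eq_sym; apply: (wf_cons_others ws').
have sc := smooth_arc (c := c) he; have wc := wf_others c ws.
rewrite /dsmooth; move: sc wc; rewrite !others_cons2 // => sc wc.
by apply: dsum_bigon => //; [apply: smooth_alternating|apply: smooth_bigon].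
Qed.

(** After smoothing either crossing of a bigon the other one is left over, and
    the two results agree.  For parallel strands the crossing left over is
    isolated; for antiparallel ones its arcs in the two cases are
    complementary and its weights opposite.  [lk] expresses that the
    linking of two chords is symmetric. *)
Lemma dsmooth_at_bigon phi s j e u v :
  wf [:: u, mate u, v, mate v & s] -> alternating j -> odd_fun phi ->
  arc_rel [:: u, mate u, v, mate v & s] e -> bigon s j e u v ->
  {in s, forall z, e u z (+) e u (mate z) = e z u (+) e z (mate u)} ->
  dsmooth phi [:: u, mate u, v, mate v & s] j e u
  = dsmooth phi [:: u, mate u, v, mate v & s] j e v.
Proof.
move=> ws fj op he [jv ez eu e1 e2] lk.
set S := [:: u, mate u, v, mate v & s].
have ws1 := wf_behead2 ws; have ws' := wf_behead2 ws1.
have uv : xing v != xing u by apply: (wf_cons_others ws); rewrite mem_head.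
have su z : z \in s -> xing z != xing u.
  by move=> zs; apply: (wf_cons_others ws); rewrite !inE zs !orbT.
have sv := wf_cons_others ws1.
have pS : perm_eq S [:: v, mate v, u, mate u & s].
  by rewrite /S -[_ :: _]/([:: u; mate u] ++ [:: v; mate v] ++ s) perm_catCA.
have ws2 : wf [:: u, mate u & s].
  by have := wf_perm pS ws => /wf_behead2.
have mem_u : u \in S by rewrite mem_head.
have mem_v : v \in S by rewrite /S !inE eqxx !orbT.
have eu' z : z \in s -> e u (mate z) = e v (mate z).
  by move=> zs; apply: eu; rewrite wf_mate.
have smj : {in s, forall z, smooth_j j e u z = smooth_j j e v z}.
  by move=> z zs; rewrite /smooth_j eu // eu'.
(* the two leftover chords have opposite weights and opposite arc sums *)
have jvu : smooth_j j e v u = - smooth_j j e u v.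
  by rewrite /smooth_j jv e1 e2 addNb addbN negbK; case: ifP; rewrite ?opprK.
rewrite /dsmooth others_cons2_id //.
have -> : others v S = [:: u, mate u & s].
  rewrite /others /= xing_mate eq_sym uv xing_mate eqxx /=.
  by rewrite -/(others v s) others_id.
have sju := smooth_alternating e u fj; have sjv := smooth_alternating e v fj.
have au : arc_rel [:: v, mate v & s] (smooth_e e u).
  by have := smooth_arc (c := u) he; rewrite others_cons2_id.
have av : arc_rel [:: u, mate u & s] (smooth_e e v).
  have := smooth_arc (c := v) he.
  rewrite /others /= xing_mate eq_sym uv xing_mate eqxx /=.
  by rewrite -/(others v s) others_id.
have a2 : arcsum s (smooth_j j e v) (smooth_e e v) u
        = - arcsum s (smooth_j j e u) (smooth_e e u) v.
  rewrite !arcsum_others //; apply/eqP; rewrite -addr_eq0 -big_split /=.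
  have h1 : \sum_(z <- s) smooth_j j e u z = 0 by apply: sum_alternating.
  have [p|p] := boolP (e u v (+) e u (mate v)).
    have h2 : \sum_(z <- s) (smooth_j j e u z *+ 2) = 0.
      by rewrite sumrMnl h1 mul0rn.
    rewrite -[X in _ == X]h2; apply/eqP; apply: eq_big_seq => z zs.
    rewrite -smj // /smooth_e e1 e2 eu //.
    move: (smooth_j j e u z) p => a.
    by case: (e u v); case: (e u (mate v)); case: (e v z) => //=;
      rewrite mulr2n.
  rewrite -[X in _ == X]h1; apply/eqP; apply: eq_big_seq => z zs.
  rewrite -smj // /smooth_e e1 e2 eu //.
  move: (smooth_j j e u z) p => a.
  by case: (e u v); case: (e u (mate v)); case: (e v z) => //=;
     rewrite ?addr0 ?add0r.
rewrite !dsum_pair //; congr (_ *+ 2 + _); first by rewrite a2 jvu op mulrNN.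
apply: eq_big_seq => z zs; rewrite -smj //; congr (_ * phi _).
rewrite !arcsum_cons !xing_mate.
have -> : xing u != xing z by rewrite eq_sym su.
have -> : xing v != xing z by rewrite eq_sym sv.
have -> : arcsum s (smooth_j j e v) (smooth_e e v) z
        = arcsum s (smooth_j j e u) (smooth_e e u) z.
  apply: eq_arcsum => w ws3 _; first by rewrite smj.
  by rewrite /smooth_e eu' // !eu.
rewrite sju sjv jvu /= /smooth_e e1 e2 -eu // -eu' //.
have [-> ->] := ez z zs; move: (lk z zs).
have [-> ->] := ez z zs.
move: (arcsum _ _ _ _) (smooth_j j e u v) => a b.
case: (e u z); case: (e u (mate z)); case: (e z v); case: (e z (mate v)) => //=;
case: (e u v); case: (e u (mate v)) => //= _; ring.
Qed.

(** * Triangles: RIII, VRIII and SV *)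

(** Three crossings [x], [y], [z] form a triangle: [x] is next to [y],
    [mate x] to [z], and [mate y] to [mate z].  The relations before and after
    the move are [e] and [e']: each pair of neighbours is transposed.
    [corner] collects the conditions at the crossing of [x]; the last one says
    that, unless [x] has weight 0, the two transpositions near the ends of its
    chord do not change its arc sum. *)
Definition corner (s : code) (j : visit -> int) (e e' : rel visit)
    (x y z : visit) : Prop :=
  [/\ {in s, forall u, e' x u = e x u},
      [/\ e' x y = ~~ e x y, e' x z = ~~ e x z,
          e' x (mate y) = e x (mate y) & e' x (mate z) = e x (mate z)],
      e x (mate y) = e x (mate z) &
      j x = 0 \/
      (if e x y then - j y else j y) + (if e x z then - j z else j z) = 0].

(** The conditions at a passage [c] outside the triangle: neighbours are on the
    same side of its chord, and the move does not affect it. *)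
Definition at_strands (e e' : rel visit) (x y z c : visit) : Prop :=
  [/\ [/\ e c x = e c y, e c (mate x) = e c z & e c (mate y) = e c (mate z)],
      [/\ e' c x = e c x, e' c y = e c y & e' c z = e c z] &
      [/\ e' c (mate x) = e c (mate x), e' c (mate y) = e c (mate y) &
          e' c (mate z) = e c (mate z)]].

(** The triangle seen from its three corners: the roles of [(x, y, z)] are
    taken over by [(y, x, mate z)] and [(z, mate x, mate y)]. *)
Definition triangle_rel (s : code) (j : visit -> int) (e e' : rel visit)
    (x y z : visit) : Prop :=
  [/\ corner s j e e' x y z, corner s j e e' y x (mate z),
      corner s j e e' z (mate x) (mate y) &
      {in s, forall v, at_strands e e' x y z v /\ {in s, e' v =1 e v}}].

Lemma arcsum_corner S s j e e' x y z :
  wf S -> perm_eq S [:: x, mate x, y, mate y, z, mate z & s] -> alternating j ->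
  arc_rel S e -> arc_rel S e' -> corner s j e e' x y z ->
  {in [:: x; mate x], forall v, j v = 0 \/ arcsum S j e v = arcsum S j e' v}.
Proof.
move=> wS pS fj he he' [es [ey ez emy emz] emm jx].
have xS : x \in S by rewrite (perm_mem pS) mem_head.
suff h : j x = 0 \/ arcsum S j e x = arcsum S j e' x.
  move=> v; rewrite !inE => /orP[]/eqP -> //.
  by rewrite !arcsum_mate // fj; case: h => ->; [left; rewrite oppr0|right].
case: jx => jx; [by left | right]; rewrite !(perm_arcsum _ _ _ pS).
have xS' := wf_cons_others (wf_perm pS wS).
rewrite !arcsum_cons !xing_mate eqxx /=.
have -> : xing y != xing x by apply: xS'; rewrite mem_head.
have -> : xing z != xing x by apply: xS'; rewrite !inE eqxx !orbT.
rewrite ey ez emy emz emm /= !fj.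
have -> : arcsum s j e' x = arcsum s j e x.
  by apply: eq_arcsum => // u us _; apply: es.
move: (arcsum _ _ _ _) (j y) (j z) jx => a b c.
by case: (e x y); case: (e x z); case: (e x (mate z)) => /=; clear; lia.
Qed.

Lemma perm_corner_y x y z s :
  perm_eq [:: x, mate x, y, mate y, z, mate z & s]
          [:: y, mate y, x, mate x, mate z, z & s].
Proof. by apply/permP => p /=; ring. Qed.

Lemma perm_corner_z x y z s :
  perm_eq [:: x, mate x, y, mate y, z, mate z & s]
          [:: z, mate z, mate x, x, mate y, y & s].
Proof. by apply/permP => p /=; ring. Qed.

Lemma arcsum_triangle s j e e' x y z
    (S := [:: x, mate x, y, mate y, z, mate z & s]) :
  wf S -> alternating j -> arc_rel S e -> arc_rel S e' ->
  triangle_rel s j e e' x y z ->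
  {in S, forall v, j v = 0 \/ arcsum S j e v = arcsum S j e' v}.
Proof.
move=> wS fj he he' [cx cy cz hs] v.
have hx := arcsum_corner wS (perm_refl S) fj he he' cx.
have hy : {in [:: y; mate y], forall v,
    j v = 0 \/ arcsum S j e v = arcsum S j e' v}.
  by apply: arcsum_corner cy => //; rewrite mateK; apply: perm_corner_y.
have hz : {in [:: z; mate z], forall v,
    j v = 0 \/ arcsum S j e v = arcsum S j e' v}.
  by apply: arcsum_corner cz => //; rewrite !mateK; apply: perm_corner_z.
have -> : S = [:: x; mate x] ++ [:: y; mate y] ++ [:: z; mate z] ++ s by [].
rewrite !mem_cat => /or4P[/hx|/hy|/hz|vs] //; right.
have [[_ [e1 e2 e3] [e4 e5 e6]] h] := hs v vs.
by apply: eq_arcsum => // u; rewrite !inE => us _;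
  case/or4P: us => [/eqP->|/eqP->|/eqP->| /or4P[/eqP->|/eqP->|/eqP->|/h]].
Qed.

Lemma dsum_triangle phi s j e e' x y z
    (S := [:: x, mate x, y, mate y, z, mate z & s]) :
  wf S -> alternating j -> arc_rel S e -> arc_rel S e' ->
  triangle_rel s j e e' x y z -> dsum phi S j e = dsum phi S j e'.
Proof.
by move=> wS fj he he' t; apply: eq_dsum => //; apply: arcsum_triangle t.
Qed.

Lemma at_strands_y e e' x y z c :
  at_strands e e' x y z c -> at_strands e e' y x (mate z) c.
Proof. by case=> [[? ? ?] [? ? ?] [? ? ?]]; split; split; rewrite ?mateK. Qed.

Lemma at_strands_z e e' x y z c :
  at_strands e e' x y z c -> at_strands e e' z (mate x) (mate y) c.
Proof. by case=> [[? ? ?] [? ? ?] [? ? ?]]; split; split; rewrite ?mateK. Qed.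

Lemma smooth_corner s j e e' x y z c :
  c \in s -> at_strands e e' x y z c -> {in s, e' c =1 e c} ->
  corner s j e e' x y z ->
  corner (others c s) (smooth_j j e c) (smooth_e e c) (smooth_e e' c) x y z.
Proof.
move=> cs [[e1 e2 e3] [e4 e5 e6] [e7 e8 e9]] h [es [ey ez emy emz] emm jx].
split.
- move=> u; rewrite mem_filter => /andP[_ us].
  by rewrite /smooth_e es // e4 e7 h.
- by rewrite /smooth_e; split;
     rewrite ?ey ?ez ?emy ?emz e4 e7 -?addNb ?e5 ?e6 ?e8 ?e9.
- by rewrite /smooth_e emm e3.
- case: jx => [jx|jx]; [left|right].
    by rewrite /smooth_j jx oppr0; case: ifP.
  rewrite /smooth_j /smooth_e e2 e1 e3; move: (j y) (j z) jx => a b.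
  case: (e c y); case: (e c z); case: (e c (mate z)); case: (e x y);
  case: (e x z) => /=; clear; lia.
Qed.

Lemma smooth_at_strands s e e' x y z c v :
  wf s -> c \in s -> v \in s ->
  {in s, forall v, at_strands e e' x y z v /\ {in s, e' v =1 e v}} ->
  at_strands (smooth_e e c) (smooth_e e' c) x y z v.
Proof.
move=> ws cs vs hs.
have [[[e1 e2 e3] [e4 e5 e6] [e7 e8 e9]] _] := hs v vs.
have [[[c1 c2 c3] [c4 c5 c6] [c7 c8 c9]] h] := hs c cs.
have mv : mate v \in s by rewrite wf_mate.
by split; split; rewrite /smooth_e ?e1 ?e2 ?e3 ?e4 ?e5 ?e6 ?e7 ?e8 ?e9
  ?c1 ?c2 ?c3 ?c4 ?c5 ?c6 ?c7 ?c8 ?c9 ?h // ?e1 ?e2 ?e3 ?c1 ?c2 ?c3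
  -?c1 -?c2 -?c3.
Qed.

Lemma smooth_triangle s j e e' x y z c :
  wf s -> c \in s -> triangle_rel s j e e' x y z ->
  triangle_rel (others c s)
    (smooth_j j e c) (smooth_e e c) (smooth_e e' c) x y z.
Proof.
move=> ws cs [cx cy cz hs]; have [h1 h2] := hs c cs.
split; first exact: smooth_corner.
- by apply: smooth_corner => //; apply: at_strands_y.
- by apply: smooth_corner => //; apply: at_strands_z.
move=> v; rewrite mem_filter => /andP[_ vs]; split.
  exact: smooth_at_strands vs hs.
move=> u; rewrite mem_filter => /andP[_ us].
have [_ h] := hs v vs; rewrite /smooth_e h // !h2 //.
by rewrite wf_mate.
Qed.

Lemma dsmooth_triangle phi s j e e' x y z c
  (S := [:: x, mate x, y, mate y, z, mate z & s]) :
  wf S -> alternating j -> arc_rel S e -> arc_rel S e' -> c \in s ->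
  triangle_rel s j e e' x y z -> dsmooth phi S j e c = dsmooth phi S j e' c.
Proof.
move=> wS fj he he' cs t.
have ws1 := wf_behead2 wS; have ws2 := wf_behead2 ws1.
have ws := wf_behead2 ws2.
have xc : xing x != xing c.
  by rewrite eq_sym; apply: (wf_cons_others wS); rewrite !inE cs !orbT.
have yc : xing y != xing c.
  by rewrite eq_sym; apply: (wf_cons_others ws1); rewrite !inE cs !orbT.
have zc : xing z != xing c by rewrite eq_sym; apply: (wf_cons_others ws2).
have sc := smooth_arc (c := c) he; have sc' := smooth_arc (c := c) he'.
have wc := wf_others c wS.
rewrite /dsmooth; move: sc sc' wc; rewrite /S !others_cons2 // => sc sc' wc.
rewrite (@dsum_triangle phi _ _ _ (smooth_e e' c)) //; first last.
- exact: smooth_triangle.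
- exact: smooth_alternating.
have hj : {in S, forall u, smooth_j j e c u = smooth_j j e' c u}.
  have [_ _ _ hs] := t; have [[_ [c4 c5 c6] [c7 c8 c9]] h] := hs c cs.
  move=> u uS; rewrite /smooth_j.
  suff he0 : {in S, e' c =1 e c} by rewrite !he0 // wf_mate.
  by move=> w; rewrite !inE; case/or4P =>
    [/eqP->|/eqP->|/eqP->| /or4P[/eqP->|/eqP->|/eqP->|/h]].
apply: eq_dsum => v; rewrite -!others_cons2 //.
  by rewrite mem_filter => /andP[_]; apply: hj.
move=> _; right; apply: eq_arcsum => // u.
by rewrite mem_filter => /andP[_ uS] _; apply: hj.
Qed.

Lemma dsum_two_pairs phi s j e y z
    (S := [:: y, mate y, z, mate z & s]) :
  wf S -> alternating j -> odd_fun phi -> arc_rel S e ->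
  dsum phi S j e =
  (j y * phi (arcsum [:: z, mate z & s] j e y)
   + j z * phi (arcsum [:: y, mate y & s] j e z)) *+ 2
  + \sum_(u <- s) j u * phi (arcsum S j e u).
Proof.
move=> ws fj op he; have zS : z \in S by rewrite !inE eqxx !orbT.
have ezy : xing z != xing y by apply: (wf_cons_others ws); rewrite mem_head.
rewrite dsum_pair // !big_cons -/S (arcsum_mate ws fj he zS) op fj mulrNN.
have -> : arcsum S j e z = arcsum [:: y, mate y & s] j e z.
  by rewrite !arcsum_cons !xing_mate eqxx /= !add0r.
move: (phi _) (phi _) (\sum_(_ <- _) _) (j y) (j z) => a b c d f; ring.
Qed.

Lemma signed_sum0 (a b : int) (p q r : bool) :
  (if p then - a else a) + (if q then - b else b) = 0 ->
  (if q (+) r then - b else b) = - (if p (+) r then - a else a).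
Proof. by case: p; case: q; case: r => /=; lia. Qed.

(** Smoothing at a corner [x] of a triangle.  The strand opposite to [x] meets
    the two arcs that replace [x] in the crossings [y] and [z], whose weights
    become opposite.  If [e x y] and [e x z] differ, [y] and [z] have equal
    arc sums and cancel, before and after the move.  Otherwise the move
    exchanges the arc sums of [y] and [z] while negating their weights. *)
Lemma dsmooth_corner phi s j e e' x y z
    (S := [:: x, mate x, y, mate y, z, mate z & s]) :
  wf S -> alternating j -> odd_fun phi -> arc_rel S e -> arc_rel S e' ->
  triangle_rel s j e e' x y z -> j x <> 0 ->
  {in s, forall u, e x u (+) e x (mate u) = e u x (+) e u (mate x)} ->
  {in s, forall u, e x u (+) e y u (+) e z u = e x (mate y)} ->
  e y z = ~~ e x (mate y) -> e z y = e x (mate y) ->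
  e z (mate y) = ~~ e y (mate z) ->
  dsmooth phi S j e x = dsmooth phi S j e' x.
Proof.
move=> wS fj op he he' [cx cy cz hs] jx lk kap eyz ezy ezmy.
have ws1 := wf_behead2 wS; have ws2 := wf_behead2 ws1.
have ws := wf_behead2 ws2.
have [ex [exy exz exmy exmz] emm sx] := cx.
have {}sx : (if e x y then - j y else j y) + (if e x z then - j z else j z) = 0.
  by case: sx.
have [ey [_ eymz _ eyz'] _ _] := cy.
have [ez [_ ezmy' _ ezy'] _ _] := cz.
rewrite mateK in eyz'; rewrite mateK in ezy'.
have a1 : arc_rel [:: y, mate y, z, mate z & s] (smooth_e e x).
  by have := smooth_arc (c := x) he; rewrite others_cons2_id.
have a2 : arc_rel [:: y, mate y, z, mate z & s] (smooth_e e' x).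
  by have := smooth_arc (c := x) he'; rewrite others_cons2_id.
have f1 := smooth_alternating e x fj; have f2 := smooth_alternating e' x fj.
rewrite /dsmooth others_cons2_id // !dsum_two_pairs //.
have ju : {in s, forall u, smooth_j j e' x u = smooth_j j e x u}.
  by move=> u us; rewrite /smooth_j !ex // wf_mate.
have jy : smooth_j j e' x y = - smooth_j j e x y.
  by rewrite /smooth_j exy exmy addNb; case: (_ (+) _); rewrite ?opprK.
have jz : smooth_j j e' x z = - smooth_j j e x z.
  by rewrite /smooth_j exz exmz addNb; case: (_ (+) _); rewrite ?opprK.
have jyz : smooth_j j e x z = - smooth_j j e x y.
  by rewrite /smooth_j emm; apply: signed_sum0.
rewrite jy jz jyz.
have zy : xing z != xing y by apply: (wf_cons_others ws1); rewrite mem_head.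
have sy u : u \in s -> xing u != xing y.
  by move=> us; apply: (wf_cons_others ws1); rewrite !inE us !orbT.
have sz := wf_cons_others ws2.
congr (_ *+ 2 + _); last first.
  apply: eq_big_seq => v vs; rewrite ju //; congr (_ * phi _).
  rewrite !arcsum_cons !xing_mate ![xing y == _]eq_sym ![xing z == _]eq_sym.
  rewrite (sy _ vs) (sz _ vs) /= f1 f2 f1 f2 jy jz jyz.
  have -> : arcsum s (smooth_j j e' x) (smooth_e e' x) v
          = arcsum s (smooth_j j e x) (smooth_e e x) v.
    apply: eq_arcsum => u us _; first exact: ju.
    have [_ h] := hs v vs; have mv : mate v \in s by rewrite wf_mate.
    by rewrite /smooth_e h // !ex.
  have [[[e1 e2 e3] [e4 e5 e6] [e7 e8 e9]] h] := hs v vs.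
  have mv : mate v \in s by rewrite wf_mate.
  rewrite /smooth_e !(ex _ mv) !(ex _ vs) e5 e6 e8 e9 exy exz exmy exmz emm.
  have := lk v vs; rewrite e1 e2 e3.
  move: (arcsum _ _ _ _) (smooth_j _ _ _ _) => a b.
  case: (e x v); case: (e x (mate v)); case: (e v y); case: (e v z) => //=;
  case: (e x y); case: (e x z); case: (e x (mate z));
    case: (e v (mate z)) => //= _;
  ring.
pose Iy g := arcsum [:: z, mate z & s] (smooth_j j g x) (smooth_e g x) y.
pose Iz g := arcsum [:: y, mate y & s] (smooth_j j g x) (smooth_e g x) z.
rewrite -/(Iy e) -/(Iz e) -/(Iy e') -/(Iz e').
have hy g : Iy g = arcsum s (smooth_j j g x) (smooth_e g x) y
    + (if smooth_e g x y z then smooth_j j g x z else 0)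
    + (if smooth_e g x y (mate z) then smooth_j j g x (mate z) else 0).
  by rewrite /Iy !arcsum_cons !xing_mate zy /= addrA addrC addrA.
have hz g : Iz g = arcsum s (smooth_j j g x) (smooth_e g x) z
    + (if smooth_e g x z y then smooth_j j g x y else 0)
    + (if smooth_e g x z (mate y) then smooth_j j g x (mate y) else 0).
  by rewrite /Iz !arcsum_cons !xing_mate eq_sym zy /= addrA addrC addrA.
have eqI g g' v v' : v \in [:: y; z] -> v' \in [:: y; z] ->
    {in s, forall u, smooth_j j g x u = smooth_j j g' x u} ->
    {in s, forall u, smooth_e g x v u = smooth_e g' x v' u} ->
    arcsum s (smooth_j j g x) (smooth_e g x) v
    = arcsum s (smooth_j j g' x) (smooth_e g' x) v'.
  move=> vyz vyz' hj hg; rewrite !arcsum_others.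
  - by apply: eq_big_seq => u us; rewrite hj // hg.
  - by move: vyz'; rewrite !inE => /orP[]/eqP ->.
  - by move: vyz; rewrite !inE => /orP[]/eqP ->.
(* outside the triangle the arcs of [y] and [z] agree, in the same word or
   across the move *)
have [E1 E2 E3 E4] :
  [/\ e x y (+) e x z ->
        {in s, forall u, smooth_e e x y u = smooth_e e x z u},
      e x y (+) e x z ->
        {in s, forall u, smooth_e e' x y u = smooth_e e' x z u},
      ~~ (e x y (+) e x z) ->
        {in s, forall u, smooth_e e' x y u = smooth_e e x z u} &
      ~~ (e x y (+) e x z) ->
        {in s, forall u, smooth_e e' x z u = smooth_e e x y u}].
  split=> + u us; rewrite /smooth_e ?exy ?exz ?exmy ?exmz emm
    ?(ex _ us) ?(ey _ us) ?(ez _ us); have := kap u us; rewrite emm;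
  by case: (e x y); case: (e x z); case: (e x (mate z)); case: (e x u);
     case: (e y u); case: (e z u).
have [h1 h2 h3 h4] :
  [/\ e x y (+) e x z -> Iy e = Iz e, e x y (+) e x z -> Iy e' = Iz e',
      ~~ (e x y (+) e x z) -> Iy e' = Iz e &
      ~~ (e x y (+) e x z) -> Iz e' = Iy e].
  split=> p; rewrite ?hy ?hz;
    rewrite 1?(eqI _ _ _ _ _ _ _ (E1 p)) 1?(eqI _ _ _ _ _ _ _ (E2 p))
            1?(eqI _ _ _ _ _ _ _ (E3 p)) 1?(eqI _ _ _ _ _ _ _ (E4 p))
            ?inE ?eqxx ?orbT //;
    rewrite ?f1 ?f2 ?jy ?jz jyz /smooth_e ?exy ?exz ?exmy ?exmz emm ?eymz
      ?ezmy' ?eyz' ?ezy' ezmy eyz ezy emm; move: p;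
    move: (arcsum _ _ _ _) (smooth_j _ _ _ _) => a b;
    by case: (e x y); case: (e x z); case: (e x (mate z));
       case: (e y (mate z)); move=> //= _; ring.
move: (smooth_j _ _ _ _) => a.
have [p|p] := boolP (e x y (+) e x z).
  by rewrite (h1 p) (h2 p); move: (phi _) (phi _) => b c; ring.
by rewrite (h3 p) (h4 p); move: (phi _) (phi _) => b c; ring.
Qed.

(** * The chords of a word *)

(** Order of first occurrence in the linear word. *)
Definition before (w : code) (u v : visit) : bool := (index u w < index v w)%N.

(** [u] lies on the cyclic arc from [v] to [mate v].  The sum modulo 2
    makes sense for both orders of [v] and [mate v]: the last term accounts for
    an arc that passes through the base edge. *)
Definition on_arc (w : code) (v u : visit) : bool :=
  before w v u (+) before w (mate v) u (+) before w (mate v) v.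

Lemma before_antisym w u v :
  u \in w -> v \in w -> u != v -> before w v u = ~~ before w u v.
Proof.
move=> uw vw uv; rewrite /before -leqNgt ltn_neqAle.
suff -> : index v w != index u w by [].
by apply: contraNneq uv => e; rewrite (index_inj visit0 vw uw e).
Qed.

Lemma beforexx w u : before w u u = false.
Proof. exact: ltnn. Qed.

Lemma arc_rel_on_arc w : wf w -> arc_rel w (on_arc w).
Proof.
move=> ww v vw u; rewrite /on_arc mateK.
have mw : mate v \in w by rewrite wf_mate.
rewrite (before_antisym mw vw (mate_neq v)).
by rewrite addbN; congr (~~ _); rewrite [before w (mate v) u (+) _]addbC.
Qed.

(** Linking of two chords is symmetric. *)
Lemma on_arc_link w v u : wf w -> v \in w -> u \in w -> xing u != xing v ->
  on_arc w v u (+) on_arc w v (mate u) = on_arc w u v (+) on_arc w u (mate v).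
Proof.
move=> ww vw uw uv.
have mv : mate v \in w by rewrite wf_mate.
have mu : mate u \in w by rewrite wf_mate.
have d a b : xing a != xing b -> a != b by apply: contraNneq => ->.
have vu : xing v != xing u by rewrite eq_sym.
rewrite /on_arc (before_antisym uw vw) ?d // (before_antisym mu vw) ?d //.
rewrite (before_antisym uw mv) ?d // (before_antisym mu mv) ?d //.
case: (before w u v); case: (before w u (mate v)); case: (before w (mate u) v);
case: (before w (mate u) (mate v)); case: (before w (mate u) u);
by case: (before w (mate v) v).
Qed.

Lemma before_filter (p : pred visit) w u v :
  p u -> p v -> before (filter p w) u v = before w u v.
Proof.
move=> pu pv; elim: w => //= z w IH; case: ifP => pz; rewrite /before /=.
  by rewrite -!/(_ == _); do 2!case: eqP => //=.
have -> : z == u = false by apply: contraFF pz => /eqP ->.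
have -> : z == v = false by apply: contraFF pz => /eqP ->.
by rewrite ltnS.
Qed.

Lemma on_arc_filter (p : pred visit) w u v :
  p u -> p v -> p (mate v) -> on_arc (filter p w) v u = on_arc w v u.
Proof. by move=> pu pv pm; rewrite /on_arc !before_filter. Qed.

Lemma on_arc_others c w u v : xing u != xing c -> xing v != xing c ->
  on_arc (others c w) v u = on_arc w v u.
Proof. by move=> uc vc; rewrite on_arc_filter. Qed.

Lemma before_cat a b u v : uniq (a ++ b) -> u \in a ++ b -> v \in a ++ b ->
  before (b ++ a) u v = before (a ++ b) u v (+) (u \in a) (+) (v \in a).
Proof.
rewrite cat_uniq !mem_cat => /and3P[_ /hasPn h _].
have d x : x \in b -> x \in a = false by move=> /h/negbTE.
rewrite /before !index_cat => uab vab.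
have lta x : x \in a -> (index x a < size a)%N by rewrite index_mem.
have ltb x : x \in b -> (index x b < size b)%N by rewrite index_mem.
case/orP: uab => uu; case/orP: vab => vv; rewrite ?(d _ uu) ?(d _ vv) ?uu ?vv.
- have -> : u \in b = false by apply/negP => /d; rewrite uu.
  have -> : v \in b = false by apply/negP => /d; rewrite vv.
  by rewrite ltn_add2l addbT addbT negbK.
- have -> : u \in b = false by apply/negP => /d; rewrite uu.
  have := lta _ uu; have := ltb _ vv; clear; lia.
- have -> : v \in b = false by apply/negP => /d; rewrite vv.
  have := lta _ vv; have := ltb _ uu; clear; lia.
- by rewrite ltn_add2l !addbF.
Qed.

Lemma on_arc_cat a b u v : wf (a ++ b) -> u \in a ++ b -> v \in a ++ b ->
  on_arc (b ++ a) v u = on_arc (a ++ b) v u.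
Proof.
move=> ww uw vw; have uq := wf_uniq ww.
have mw : mate v \in a ++ b by rewrite wf_mate.
rewrite /on_arc !(before_cat uq) //.
by case: (v \in a); case: (u \in a); case: (mate v \in a);
   case: (before _ v u); case: (before _ (mate v) u);
   case: (before _ (mate v) v).
Qed.

Lemma on_arc_rot k w u v : wf w -> u \in w -> v \in w ->
  on_arc (rot k w) v u = on_arc w v u.
Proof.
move=> ww uw vw; rewrite -{2}(cat_take_drop k w) /rot.
by rewrite on_arc_cat // cat_take_drop.
Qed.

Lemma index_rev (s : code) x : uniq s -> x \in s ->
  index x (rev s) = (size s - (index x s).+1)%N.
Proof.
move=> us xs; have lt := xs; rewrite -index_mem in lt.
have lt' : (size s - (index x s).+1 < size (rev s))%N.
  by rewrite size_rev subnSK // leq_subr.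
rewrite -[RHS](index_uniq visit0 lt') ?rev_uniq // nth_rev; last first.
  by move: lt'; rewrite size_rev.
by rewrite subnSK // subKn ?nth_index // ltnW.
Qed.

Lemma before_cat_rev a b u v : uniq (a ++ b) -> u != v ->
  u \in a ++ b -> v \in a ++ b ->
  before (a ++ rev b) u v = before (a ++ b) u v (+) ((u \in b) && (v \in b)).
Proof.
rewrite cat_uniq !mem_cat => /and3P[_ /hasPn h ub] uv.
have d x : x \in b -> x \in a = false by move=> /h/negbTE.
rewrite /before !index_cat => uab vab.
have lta x : x \in a -> (index x a < size a)%N by rewrite index_mem.
have ltb x : x \in b -> (index x b < size b)%N by rewrite index_mem.
case/orP: uab => uu; case/orP: vab => vv; rewrite ?(d _ uu) ?(d _ vv) ?uu ?vv.
- have -> : u \in b = false by apply/negP => /d; rewrite uu.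
  by rewrite addbF.
- have -> : u \in b = false by apply/negP => /d; rewrite uu.
  have := lta _ uu; rewrite addbF; clear; lia.
- have -> : v \in b = false by apply/negP => /d; rewrite vv.
  have := lta _ vv; rewrite andbF addbF; clear; lia.
- have e : index u b != index v b.
    by apply: contraNneq uv => e; rewrite (index_inj visit0 uu vv e).
  rewrite !index_rev // !ltn_add2l /= addbT -leqNgt.
  have := ltb _ uu; have := ltb _ vv; move: e.
  move: (index u b) (index v b) (size b) => i k n; clear; lia.
Qed.

Lemma before_map g w u v :
  uniq w -> {in w &, injective g} -> u \in w -> v \in w ->
  before (map g w) (g u) (g v) = before w u v.
Proof.
move=> uqw gi uw vw.
have h x : x \in w -> index (g x) (map g w) = index x w.
  move=> xw; rewrite -[in RHS](nth_index_map visit0 gi xw) index_uniq //.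
  by rewrite -(size_map g) index_mem map_f.
by rewrite /before !h.
Qed.

Lemma on_arc_map g w u v : {in w &, injective g} -> wf w ->
  {in w, forall x, g (mate x) = mate (g x)} -> u \in w -> v \in w ->
  on_arc (map g w) (g v) (g u) = on_arc w v u.
Proof.
move=> gi ww gm uw vw; have mw : mate v \in w by rewrite wf_mate.
by rewrite /on_arc -gm // !before_map ?wf_uniq.
Qed.

Lemma find_index (p : pred visit) (w : code) (v : visit) :
  {in w, forall u, p u = (u == v)} -> find p w = index v w.
Proof.
exact: eq_in_find.
Qed.

Lemma find_visit w v (p : pred visit) :
  wf w -> v \in w -> p v -> ~~ p (mate v) ->
  find (fun u => (xing u == xing v) && p u) w = index v w.
Proof.
move=> ww vw pv pm; apply: find_index => u uw.
apply/andP/eqP => [[/eqP e pu]|->]; last by rewrite eqxx.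
by have [//|e'] := wf_xing ww vw uw e; rewrite -e' pu in pm.
Qed.

Lemma sgn_jump w v : wf w -> v \in w -> lev v = Over ->
  sgn w (xing v) = - jump v.
Proof.
case: v => [[c l] b] ww vw /= le; rewrite /lev /= in le; subst l.
rewrite /sgn /xing /jump /=; case: ifP; case: b vw => vw //= h.
  by have [] := wf_xing ww vw h erefl.
by rewrite vw in h.
Qed.

Lemma take_before w v : uniq w -> v \in w ->
  take (index v w) w = [seq u <- w | before w u v].
Proof.
move=> uqw vw; have sub := take_subseq w (index v w).
rewrite {1}(elimT (subseq_uniqP uqw) sub).
by apply: eq_in_filter => u uw; rewrite in_take.
Qed.

Lemma arc_label_before w v : wf w -> v \in w ->
  arc_label w (in_edge w (index v w)) = \sum_(u <- w | before w u v) jump u.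
Proof.
move=> ww vw; rewrite -big_filter -take_before ?wf_uniq // /arc_label.
case: (index v w) => [|i] //=; rewrite take0 big_nil.
by rewrite prednK ?take_size ?sum_jump //; case: w vw {ww}.
Qed.

(** The difference of the labels before [mate r] and before [r] is the sum of
    the jumps from [r], included, up to [mate r]; removing [jump r = 1] leaves
    the open arc. *)
Lemma ind_by_arcsum w r : wf w -> r \in w -> jump r = 1 ->
  \sum_(u <- w | before w u (mate r)) jump u
    - \sum_(u <- w | before w u r) jump u - 1
  = arcsum w jump (on_arc w) r.
Proof.
move=> ww rw jr; have mw : mate r \in w by rewrite wf_mate.
have pw := wf_split ww rw.
rewrite (perm_arcsum _ _ _ pw) !arcsum_cons !xing_mate eqxx /= !add0r.
rewrite !(perm_big _ pw) /= !big_cons !beforexx jump_mate jr.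
rewrite (before_antisym rw mw) 1?eq_sym ?mate_neq //.
rewrite arcsum_others; last by move=> u; rewrite mem_filter => /andP[].
have ws := wf_others r ww; have := sum_jump ws => h0.
have hd u : u \in others r w -> [/\ u \in w, u != r & u != mate r].
  rewrite mem_filter => /andP[ur uw]; split => //.
    by apply: contraNneq ur => ->.
  by apply: contraNneq ur => ->; rewrite xing_mate.
have -> : \sum_(u <- others r w) (if on_arc w r u then jump u else 0)
  = \sum_(u <- others r w | before w u (mate r)) jump u
    - \sum_(u <- others r w | before w u r) jump u.
  rewrite [in RHS]big_mkcond [X in _ = _ - X]big_mkcond /= -sumrB.
  case t: (before w r (mate r)); last first.
    rewrite -[RHS]addr0 -[X in _ = _ + X]h0 -big_split /=;
      apply: eq_big_seq => u us.
    have [uw ur um] := hd u us.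
    rewrite /on_arc (before_antisym rw mw) ?t 1?eq_sym ?mate_neq //.
    rewrite (before_antisym uw rw) // (before_antisym uw mw) //.
    move: t; rewrite /before.
    case: ltnP => // a1 _; case: ltnP => a2; case: ltnP => a3 //=; try ring.
    by exfalso; move: a1 a2 a3; clear; lia.
  apply: eq_big_seq => u us.
  have [uw ur um] := hd u us.
  rewrite /on_arc (before_antisym rw mw) ?t 1?eq_sym ?mate_neq //.
  rewrite (before_antisym uw rw) // (before_antisym uw mw) //.
  move: t; rewrite /before.
  case: ltnP => // a1 _; case: ltnP => a2; case: ltnP => a3 //=; try ring.
  by exfalso; move: a1 a2 a3; clear; lia.
move: (\sum_(_ <- _ | _) _) (\sum_(_ <- _ | _) _) => a b.
by case: (before w r (mate r)) => /=; ring.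
Qed.

Lemma jump_alternating : alternating jump. Proof. exact: jump_mate. Qed.

Lemma ind_arcsum w v : wf w -> v \in w -> lev v = Over ->
  ind w (xing v) = - arcsum w jump (on_arc w) v.
Proof.
move=> ww vw vo; have mw : mate v \in w by rewrite wf_mate.
have h := arc_rel_on_arc ww.
rewrite /ind /ind_by (sgn_jump ww vw vo) /left_visit /right_visit.
have jv : jump v = if from_left v then 1 else -1 by rewrite /jump vo.
case: (boolP (from_left v)) jv => fv jv.
  rewrite (@find_visit w v from_left) //= ?negbK //.
  rewrite -(xing_mate v) (@find_visit w (mate v) (predC from_left)) //=.
  - by rewrite !arc_label_before // ind_by_arcsum // jv mulN1r.
  - by rewrite negbK.
  - by rewrite !negbK.
rewrite (@find_visit w v (predC from_left)) //= ?negbK //.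
rewrite -(xing_mate v) (@find_visit w (mate v) from_left) //= ?mateK //.
have jm : jump (mate v) = 1 by rewrite jump_mate jv opprK.
have := ind_by_arcsum ww mw jm; rewrite mateK !arc_label_before // jv => ->.
rewrite opprK mul1r.
  by rewrite (arcsum_mate ww jump_alternating h vw).
by rewrite negbK.
Qed.

(** The contribution of a positive crossing of index [i] to the [n]-th
    dwrithe. *)
Definition spike (n : nat) (i : int) : int := (i == n%:Z)%:Z - (i == - n%:Z)%:Z.

Lemma odd_spike n : odd_fun (spike n).
Proof. by move=> i; rewrite /spike eqr_oppLR eqr_opp opprB. Qed.

(** As [spike n] is odd, the signs of the crossings are absorbed in their
    jumps. *)
Lemma dwrithe_over n w : wf w ->
  dwrithe n w
  = \sum_(v <- w | lev v == Over) jump v * spike n (arcsum w jump (on_arc w) v).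
Proof.
move=> ww; rewrite /dwrithe /writhe /classical !big_map !big_filter_cond.
rewrite !big_mkcondr /= -sumrB big_seq_cond [RHS]big_seq_cond.
apply: eq_bigr => v /andP[vw /eqP vo].
rewrite ind_arcsum // sgn_jump // eqr_oppLR eqr_opp /spike.
by case: eqP => [->|_]; case: eqP => _ /=; ring.
Qed.

Lemma dsum_dwrithe n w : wf w ->
  dsum (spike n) w jump (on_arc w) = dwrithe n w *+ 2.
Proof.
move=> ww; rewrite dwrithe_over // mulr2n.
have he := arc_rel_on_arc ww.
have op := odd_spike n.
rewrite /dsum (bigID (fun v => lev v == Over)) /=; congr (_ + _).
have pm : perm_eq (map mate w) w.
  apply: uniq_perm; rewrite ?(map_inj_uniq (inv_inj mateK)) ?wf_uniq // => v.
  by rewrite -[v]mateK (mem_map (inv_inj mateK)) mateK (wf_mate _ ww).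
rewrite -(perm_big _ pm) big_map /= big_seq_cond [RHS]big_seq_cond.
rewrite big_mkcond [RHS]big_mkcond /=; apply: eq_bigr => v _.
case vw: (v \in w) => //=.
rewrite (arcsum_mate ww jump_alternating he vw) jump_mate op mulrNN.
by rewrite /jump; case: v vw => [[c []] b] //= _; rewrite mul0r.
Qed.

(** * Smoothing of words *)

Lemma arcsum_map g w (j j' : visit -> int) (e e' : rel visit) v :
  v \in w ->
  {in w &, forall u v, (xing (g u) == xing (g v)) = (xing u == xing v)} ->
  {in w, forall v, j' (g v) = j v} ->
  {in w &, forall v u, xing u != xing v -> e' (g v) (g u) = e v u} ->
  arcsum (map g w) j' e' (g v) = arcsum w j e v.
Proof.
move=> vw gx gj ge; rewrite /arcsum big_map /= big_seq_cond [RHS]big_seq_cond.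
apply: eq_big => u; first by case uw: (u \in w); rewrite //= gx.
by rewrite /= => /andP[uw]; rewrite gx // => uv; rewrite gj // ge.
Qed.

Lemma dsum_map phi g w (j j' : visit -> int) (e e' : rel visit) :
  {in w &, forall u v, (xing (g u) == xing (g v)) = (xing u == xing v)} ->
  {in w, forall v, j' (g v) = j v} ->
  {in w &, forall v u, xing u != xing v -> e' (g v) (g u) = e v u} ->
  dsum phi (map g w) j' e' = dsum phi w j e.
Proof.
move=> gx gj ge; rewrite /dsum big_map; apply: eq_big_seq => v vw.
by rewrite gj // (@arcsum_map _ _ j _ e).
Qed.

Lemma dsmooth_map phi g w (j j' : visit -> int) (e e' : rel visit) c :
  wf w -> c \in w -> {in w, forall x, g (mate x) = mate (g x)} ->
  {in w &, forall u v, (xing (g u) == xing (g v)) = (xing u == xing v)} ->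
  {in w, forall v, j' (g v) = j v} ->
  {in w &, forall v u, xing u != xing v -> e' (g v) (g u) = e v u} ->
  dsmooth phi (map g w) j' e' (g c) = dsmooth phi w j e c.
Proof.
move=> ww cw gm gx gj ge; rewrite /dsmooth.
have -> : others (g c) (map g w) = map g (others c w).
  by rewrite /others filter_map; congr map; apply: eq_in_filter => u uw /=;
    rewrite gx.
have mem u : u \in others c w ->
    [/\ u \in w, xing u != xing c, mate u \in w & xing (mate u) != xing c].
  by rewrite mem_filter => /andP[uc uw]; rewrite wf_mate.
have gc u : u \in others c w ->
    e' (g c) (g u) = e c u /\ e' (g c) (mate (g u)) = e c (mate u).
  by move=> /mem[? ? ? ?]; rewrite -gm // !ge.
apply: dsum_map => [u v /mem[? _ _ _] /mem[? _ _ _]|u us|v u vs us uv].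
- exact: gx.
- have [uw _ _ _] := mem u us; have [e1 e2] := gc u us.
  by rewrite /smooth_j e1 e2 gj.
have [uw _ _ _] := mem u us; have [vw _ _ _] := mem v vs.
have [e1 _] := gc u us; have [e2 e3] := gc v vs.
by rewrite /smooth_e e1 e2 e3 ge.
Qed.

Lemma wf_map_inj g w : wf w -> {in w, forall x, g (mate x) = mate (g x)} ->
  {in w &, forall u v, (xing (g u) == xing (g v)) = (xing u == xing v)} ->
  {in w &, injective g}.
Proof.
move=> ww gm gx u v uw vw e.
have /eqP x : xing u == xing v by rewrite -gx // e.
have [//|e'] := wf_xing ww vw uw x.
by move: (mate_neq (g v)); rewrite -gm // -e' e eqxx.
Qed.

Lemma smoothing_split w v : wf w -> v \in w -> lev v = Over ->
  exists k A B, rot k w = v :: A ++ mate v :: B /\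
    smoothing (xing v) w
    = map (flip_if_separated B) A ++ rev (map (flip_if_separated A) B).
Proof.
move=> ww vw vo; rewrite /smoothing.
rewrite (@find_visit w v (fun u => lev u == Over)) ?vo //;
  last by rewrite /lev /= -/(lev v) vo.
have [r er] : exists r, rot (index v w) w = v :: r.
  by exists (drop (index v w).+1 w ++ take (index v w) w);
     rewrite /rot (drop_nth visit0) ?index_mem // nth_index.
rewrite er /=; set k := find _ r.
have wr : wf (v :: r) by rewrite -er (wf_perm _ ww) // perm_sym perm_rot.
have mr : mate v \in r.
  by have := mem_head v r; rewrite -(wf_mate v wr) inE (negbTE (mate_neq v)).
have ek : k = index (mate v) r.
  apply: find_index => u ur; apply/eqP/eqP => [e|->] //.
  have ur' : u \in v :: r by rewrite inE ur orbT.
  have [e'|//] := wf_xing wr (mem_head v r) ur' e.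
  by have := wf_uniq wr; rewrite /= -e' ur.
exists (index v w), (take k r), (drop k.+1 r); split => //.
rewrite er; congr (_ :: _); rewrite -[LHS](cat_take_drop k); congr (_ ++ _).
by rewrite (drop_nth visit0) ek ?index_mem // nth_index.
Qed.

(** The word [smoothing (xing v) w] is the image under [g] of [A ++ rev B],
    where [g] changes the direction of crossing at the separated chords. *)
Lemma dsum_smoothing phi w v : wf w -> v \in w -> lev v = Over ->
  dsum phi (smoothing (xing v) w) jump (on_arc (smoothing (xing v) w))
  = dsmooth phi w jump (on_arc w) v.
Proof.
move=> ww vw vo; have [k [A [B [er ->]]]] := smoothing_split ww vw vo.
have pw : perm_eq w (v :: A ++ mate v :: B).
  by rewrite -er perm_sym perm_rot.
have wr := wf_perm pw ww.
have pw2 : perm_eq (v :: A ++ mate v :: B) [:: v, mate v & A ++ B].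
  by rewrite perm_cons -cat_rcons -cats1 -catA perm_catCA.
have wr2 := wf_perm pw2 wr; have wAB := wf_behead2 wr2.
have xAB := wf_cons_others wr2.
have uAB := wf_uniq wAB; have := uAB.
rewrite cat_uniq => /and3P[_ /hasPn dAB _].
have dB x : x \in B -> (x \in A) = false by move=> /dAB/negbTE.
have mAB x : x \in A ++ B -> (x \in B) = ~~ (x \in A).
  by rewrite mem_cat; case xB: (x \in B); rewrite ?(dB _ xB) // orbF => ->.
pose g u := if u \in A then flip_if_separated B u else flip_if_separated A u.
have -> : map (flip_if_separated B) A ++ rev (map (flip_if_separated A) B)
        = map g (A ++ rev B).
  rewrite map_cat map_rev; congr (_ ++ rev _).
    by apply/eq_in_map => u uA; rewrite /g uA.
  by apply/eq_in_map => u /dB uA; rewrite /g uA.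
have ps : perm_eq (A ++ B) (A ++ rev B) by rewrite perm_cat2l perm_sym perm_rev.
set s := A ++ rev B; have ws := wf_perm ps wAB.
have memS u : (u \in s) = (u \in A ++ B) by rewrite (perm_mem ps).
have xg u : xing (g u) = xing u.
  by rewrite /g /flip_if_separated; do !case: ifP.
have ge u : u \in s -> g u
    = if (u \in A) (+) (mate u \in A)
      then (xing u, lev u, ~~ from_left u) else u.
  rewrite memS => us; have mus : mate u \in A ++ B by rewrite wf_mate.
  rewrite /g /flip_if_separated (mAB _ mus).
  by case: (u \in A); case: (mate u \in A).
have gm : {in s, forall u, g (mate u) = mate (g u)}.
  move=> u us; have mus : mate u \in s by rewrite wf_mate.
  by rewrite !ge // mateK addbC; case: ifP.
have gx : {in s &, forall u v, (xing (g u) == xing (g v)) = (xing u == xing v)}.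
  by move=> *; rewrite !xg.
have gi := wf_map_inj ws gm gx.
(* an end of another chord lies on the arc leaving [v] iff it lies in [A] *)
have hA u : u \in s -> on_arc w v u = (u \in A).
  rewrite memS => us.
  have ur : u \in v :: A ++ mate v :: B by rewrite (perm_mem pw2) !inE us !orbT.
  have uw : u \in w by rewrite (perm_mem pw).
  rewrite -(on_arc_rot k ww) // er.
  have nv : (v == u) = false.
    by apply: contraNF (xAB u us) => /eqP ->.
  have nm : (mate v == u) = false.
    by apply: contraNF (xAB u us) => /eqP <-.
  have mA : mate v \in A = false.
    by apply/negP => mA; have := wf_uniq wr2; rewrite /= mem_cat mA andbF.
  have vm : (v == mate v) = false by rewrite eq_sym (negbTE (mate_neq v)).
  rewrite /on_arc /before /= eqxx nv vm ltn0 addbF ltnS !index_cat mA /=.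
  rewrite eqxx addn0 nm; case: ifP => uA.
    by rewrite ltnS -leqNgt index_size.
  by rewrite ltnS addnS ltnS leq_addr.
rewrite (@dsum_map _ _ _ (jump \o g) _ (on_arc s)) //; last first.
  by move=> x u xs us _; apply: on_arc_map.
rewrite /dsmooth.
have po : perm_eq (others v w) s.
  rewrite (perm_trans (perm_filter _ (perm_trans pw pw2))) //.
  by rewrite -/(others v _) others_cons2_id.
rewrite (perm_dsum _ _ _ po).
have hm u : u \in s -> mate u \in s by rewrite wf_mate.
have hj : {in s, forall u, (jump \o g) u = smooth_j jump (on_arc w) v u}.
  move=> u us; rewrite /= ge // /smooth_j !hA ?hm //; case: ifP => //= _.
  by rewrite /jump /lev /from_left /=; case: u {us} => [[? []] []].
apply: eq_dsum => // x xs; right; apply: eq_arcsum => u us ux; first exact: hj.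
have neq a b : xing a != xing b -> a != b by apply: contraNneq => ->.
have xu : xing x != xing u by rewrite eq_sym.
have xm := hm _ xs.
have n1 := neq _ _ xu; have n2 : mate x != u by apply: neq; rewrite xing_mate.
rewrite /smooth_e !hA // /on_arc !before_cat_rev -?memS ?n1 ?n2 ?mate_neq //.
rewrite -/(on_arc _ _ _).
have -> : on_arc w x u = on_arc (A ++ B) x u.
  have inw z : z \in s -> z \in w.
    by move=> zs; rewrite (perm_mem (perm_trans pw pw2)) !inE -memS zs !orbT.
  rewrite -(on_arc_rot k ww) ?inw // er.
  rewrite -(@on_arc_others v (v :: _)) ?xAB -?memS //.
  congr (on_arc _ x u).
  rewrite /others /= eqxx /= filter_cat /= xing_mate eqxx /= -filter_cat.
  by rewrite -/(others v _) others_id.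
rewrite /on_arc !mAB -?memS //.
by case: (x \in A); case: (u \in A); case: (mate x \in A);
   case: (before _ x u); case: (before _ (mate x) u);
   case: (before _ (mate x) x).
Qed.

(** * Sums over crossings *)

(** The contribution of the crossing with overpassage [v]; the absolute value
    makes it independent of the orientation of the smoothed diagram. *)
Definition crossing_term (phi : int -> int) (f : int -> int -> int) (s : code)
    (j : visit -> int) (e : rel visit) (v : visit) : int :=
  j v * f (arcsum s j e v) `|dsmooth phi s j e v|.

(** Each classical crossing is counted once, through its overpassage [v], for
    which [j v] is the opposite of the sign and [arcsum s j e v] the opposite of
    the index. *)
Definition crossing_sum (phi : int -> int) (f : int -> int -> int) (s : code)
    (j : visit -> int) (e : rel visit) : int :=
  \sum_(v <- s | lev v == Over) crossing_term phi f s j e v.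

Lemma eq_crossing_sum phi f s s' j e e' : perm_eq s s' ->
  {in s, forall v,
     crossing_term phi f s j e v = crossing_term phi f s' j e' v} ->
  crossing_sum phi f s j e = crossing_sum phi f s' j e'.
Proof.
move=> ps h; rewrite /crossing_sum -(perm_big _ ps) /= big_seq_cond
  [RHS]big_seq_cond.
by apply: eq_bigr => v /andP[vs _]; apply: h.
Qed.

Lemma perm_crossing_sum phi f s s' j e : perm_eq s s' ->
  crossing_sum phi f s j e = crossing_sum phi f s' j e.
Proof.
move=> ps; apply: eq_crossing_sum => // v _.
by rewrite /crossing_term (perm_arcsum _ _ _ ps) (perm_dsmooth _ _ _ _ ps).
Qed.

(** The hypothesis on [f] makes the contribution of an isolated crossing
    vanish: its index is 0 and smoothing it removes it, up to reversal. *)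
Lemma crossing_sum_isolated phi f s j e v b :
  wf [:: v, mate v & s] -> alternating j -> odd_fun phi ->
  arc_rel [:: v, mate v & s] e ->
  {in s, forall u, e v u = b} -> {in s, forall u, e u v = e u (mate v)} ->
  f 0 `|dsum phi s j e| = 0 ->
  crossing_sum phi f [:: v, mate v & s] j e = crossing_sum phi f s j e.
Proof.
move=> ws fj op he hv hu f0; have vS := mem_head v (mate v :: s).
have z1 : crossing_term phi f [:: v, mate v & s] j e v = 0.
  rewrite /crossing_term (arcsum_isolated_self ws fj hv).
  by rewrite (dsmooth_at_isolated ws fj op he hv) f0 mulr0.
have z2 : crossing_term phi f [:: v, mate v & s] j e (mate v) = 0.
  rewrite /crossing_term (arcsum_mate ws fj he vS) (dsmooth_mate ws fj op he
    vS).
  rewrite (arcsum_isolated_self ws fj hv) oppr0 normrN.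
  by rewrite (dsmooth_at_isolated ws fj op he hv) f0 mulr0.
rewrite /crossing_sum !big_cons z1 z2 !add0r !if_same.
rewrite big_seq_cond [RHS]big_seq_cond.
apply: eq_bigr => u /andP[us _]; rewrite /crossing_term arcsum_isolated ?hu //.
by rewrite (dsmooth_isolated (b := b)).
Qed.

Lemma crossing_sum_bigon phi f s j e u v :
  wf [:: u, mate u, v, mate v & s] -> alternating j -> odd_fun phi ->
  arc_rel [:: u, mate u, v, mate v & s] e -> bigon s j e u v ->
  {in s, forall z, e u z (+) e u (mate z) = e z u (+) e z (mate u)} ->
  lev u = lev v ->
  crossing_sum phi f [:: u, mate u, v, mate v & s] j e
    = crossing_sum phi f s j e.
Proof.
move=> ws fj op he b lk luv; have [jv _ _ _ _] := b.
set S := [:: u, mate u, v, mate v & s].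
have uS : u \in S by rewrite mem_head.
have vS : v \in S by rewrite !inE eqxx !orbT.
have t1 : crossing_term phi f S j e v = - crossing_term phi f S j e u.
  rewrite /crossing_term (arcsum_bigon_sides ws fj b).
  by rewrite (dsmooth_at_bigon ws fj op he b lk) jv mulNr.
have t2 : crossing_term phi f S j e (mate v)
  = - crossing_term phi f S j e (mate u).
  rewrite /crossing_term !(arcsum_mate ws fj he) // !(dsmooth_mate ws fj op he)
    //.
  rewrite (arcsum_bigon_sides ws fj b) !fj.
  by rewrite (dsmooth_at_bigon ws fj op he b lk) jv !mulNr.
have lm : lev (mate u) = lev (mate v).
  by rewrite /lev /= -/(lev u) -/(lev v) luv.
rewrite /crossing_sum !big_cons t1 t2 luv lm.
have -> : \sum_(z <- s | lev z == Over) crossing_term phi f S j e z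
        = \sum_(z <- s | lev z == Over) crossing_term phi f s j e z.
  rewrite big_seq_cond [RHS]big_seq_cond.
  apply: eq_bigr => z /andP[zs _]; rewrite /crossing_term (arcsum_bigon ws fj b
    zs).
  by rewrite (dsmooth_bigon ws fj op he b zs).
move: (crossing_term _ _ _ _ _ u) (crossing_term _ _ _ _ _ (mate u)) => a c.
by case: (lev v == Over); case: (lev (mate v) == Over); ring.
Qed.

(** What holds besides [triangle_rel] for the chords of a word, at the corner
    [x]: symmetric linking with the other chords; the three arcs of the triangle
    add up to nothing or to the whole curve, according to the cyclic order
    of the three strands, modulo 2; the mutual position of [y] and [z]. *)
Definition triangle_shape (s : code) (e : rel visit) (x y z : visit) : Prop :=
  [/\ {in s, forall u, e x u (+) e x (mate u) = e u x (+) e u (mate x)},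
      {in s, forall u, e x u (+) e y u (+) e z u = e x (mate y)},
      e y z = ~~ e x (mate y), e z y = e x (mate y) &
      e z (mate y) = ~~ e y (mate z)].

Lemma crossing_term_corner phi f S s j e e' x y z :
  perm_eq S [:: x, mate x, y, mate y, z, mate z & s] ->
  wf S -> alternating j -> odd_fun phi -> arc_rel S e -> arc_rel S e' ->
  triangle_rel s j e e' x y z -> triangle_shape s e x y z ->
  {in [:: x; mate x], forall v,
     crossing_term phi f S j e v = crossing_term phi f S j e' v}.
Proof.
move=> pS wS fj op he he' t [lk kap eyz ezy ezmy].
have xS : x \in S by rewrite (perm_mem pS) mem_head.
have [j0|j0] := eqVneq (j x) 0.
  by move=> v; rewrite !inE => /orP[]/eqP ->;
    rewrite /crossing_term ?fj j0 ?oppr0 !mul0r.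
have wS' := wf_perm pS wS.
have hS e1 : arc_rel S e1 ->
    arc_rel [:: x, mate x, y, mate y, z, mate z & s] e1.
  by move=> h v; rewrite -(perm_mem pS); apply: h.
have hd : dsmooth phi S j e x = dsmooth phi S j e' x.
  rewrite !(perm_dsmooth _ _ _ _ pS).
  by apply: dsmooth_corner => //; [apply: hS|apply: hS|apply/eqP].
have [cx _ _ _] := t.
have ha : arcsum S j e x = arcsum S j e' x.
  have [j0'|//] := arcsum_corner wS pS fj he he' cx (mem_head _ _).
  by rewrite j0' eqxx in j0.
move=> v; rewrite !inE => /orP[]/eqP ->; rewrite /crossing_term;
  first by rewrite hd ha.
by rewrite !(arcsum_mate wS) // !dsmooth_mate // hd ha.
Qed.

(** * Moves on words *)

Definition word_dsum (phi : int -> int) (w : code) : int :=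
  dsum phi w jump (on_arc w).

Definition word_crossing_sum (phi : int -> int) (f : int -> int -> int)
    (w : code) : int :=
  crossing_sum phi f w jump (on_arc w).

(** The relation between words that all moves are shown to respect.  The
    condition on [f] is the same for both words by the first component. *)
Definition same_sums (phi : int -> int) (w w' : code) : Prop :=
  word_dsum phi w = word_dsum phi w' /\
  (forall f : int -> int -> int, f 0 `|word_dsum phi w| = 0 ->
     word_crossing_sum phi f w = word_crossing_sum phi f w').

(** No passage of [w] lies between [u] and [v]. *)
Definition adjacent (w : code) (u v : visit) : Prop :=
  [/\ u \in w, v \in w, u != v &
      {in w, forall z, z != u -> z != v -> before w z u = before w z v}].

Lemma adjacent_sym w u v : adjacent w u v -> adjacent w v u.
Proof.
case=> uw vw uv h; split; rewrite 1?eq_sym // => z zw zv zu.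
by rewrite h.
Qed.

Lemma adjacent_before w u v z : adjacent w u v -> z \in w ->
  z != u -> z != v -> before w u z = before w v z.
Proof.
case=> uw vw _ h zw zu zv.
by rewrite (before_antisym zw uw) // (before_antisym zw vw) // h.
Qed.

Lemma adjacent_infix a u v b :
  uniq (a ++ [:: u; v] ++ b) -> adjacent (a ++ [:: u; v] ++ b) u v.
Proof.
move=> uq; set w := a ++ _; have uw : u \in w by rewrite !mem_cat mem_head orbT.
have vw : v \in w by rewrite !mem_cat !inE eqxx !orbT.
have iv : index v w = (index u w).+1.
  move: uq; rewrite cat_uniq => /and3P[_ /hasPn h /= /and3P[]].
  rewrite inE negb_or => /andP[/negbTE uv _] _ _.
  rewrite /w !index_cat (negbTE (h v _)) ?(negbTE (h u _)) ?inE ?eqxx ?orbT //.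
  by rewrite /= !eqxx uv addn0 addn1.
split=> //; first by apply/eqP => e; move: iv; rewrite e; clear; lia.
move=> z zw zu zv; rewrite /before iv.
have : index z w != index u w.
  by apply: contraNneq zu => e; rewrite (index_inj visit0 zw uw e).
move: (index z w) (index u w) => m n; clear; lia.
Qed.

Lemma on_arc_adjacent w c u v : wf w -> adjacent w u v -> c \in w ->
  xing c != xing u -> xing c != xing v -> on_arc w c u = on_arc w c v.
Proof.
move=> ww [uw vw uv h] cw cu cv; rewrite /on_arc !h ?wf_mate //.
- by apply: contraNneq cu => <-.
- by apply: contraNneq cv => <-.
- by apply: contraNneq cu => ->.
- by apply: contraNneq cv => ->.
Qed.

Lemma eq_dsum_arc phi s j e e' : {in s &, forall v u, e v u = e' v u} ->
  dsum phi s j e = dsum phi s j e'.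
Proof.
move=> h; apply: eq_dsum => // v vs; right.
by apply: eq_arcsum => // u us _; apply: h.
Qed.

Lemma eq_dsmooth_arc phi s j e e' c : wf s -> c \in s ->
  {in s &, forall v u, e v u = e' v u} ->
  dsmooth phi s j e c = dsmooth phi s j e' c.
Proof.
move=> ws cs h.
have mem u : u \in others c s -> u \in s /\ mate u \in s.
  by rewrite mem_filter => /andP[_ us]; rewrite wf_mate.
have hj : {in others c s, forall u, smooth_j j e c u = smooth_j j e' c u}.
  by move=> u /mem[us ms]; rewrite /smooth_j !h.
apply: eq_dsum => // v /mem[vs mvs]; right; apply: eq_arcsum => u us _.
  exact: hj.
by have [us' mus] := mem u us; rewrite /smooth_e !h.
Qed.

Lemma eq_crossing_sum_arc phi f s s' j e e' : wf s -> perm_eq s s' ->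
  {in s &, forall v u, e v u = e' v u} ->
  crossing_sum phi f s j e = crossing_sum phi f s' j e'.
Proof.
move=> ws ps h; rewrite -(perm_crossing_sum phi f j e' ps).
apply: eq_crossing_sum => // v vs; rewrite /crossing_term (eq_dsmooth_arc _ _
  ws vs h).
by congr (_ * f _ _); apply: eq_arcsum => // u us _; apply: h.
Qed.

Lemma same_perm phi w w' : wf w -> perm_eq w w' ->
  {in w &, forall v u, on_arc w v u = on_arc w' v u} -> same_sums phi w w'.
Proof.
move=> ww pw h; split=> [|f _]; last exact: eq_crossing_sum_arc.
by rewrite /word_dsum -(perm_dsum _ _ _ pw); apply: eq_dsum_arc.
Qed.

Lemma same_RI phi w v : wf w -> odd_fun phi -> adjacent w v (mate v) ->
  same_sums phi (others v w) w.
Proof.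
move=> ww op ad; have [vw _ vm h] := ad; have pw := wf_split ww vw.
have ws := wf_perm pw ww; set s := others v w in pw ws *.
have he : arc_rel [:: v, mate v & s] (on_arc w).
  by move=> u; rewrite -(perm_mem pw); apply: arc_rel_on_arc.
have ms u : u \in s -> [/\ u \in w, xing u != xing v, u != v & u != mate v].
  rewrite mem_filter => /andP[uv uw]; split=> //.
    by apply: contraNneq uv => ->.
  by apply: contraNneq uv => ->.
have hv : {in s, forall u, on_arc w v u = before w (mate v) v}.
  move=> u /ms[uw _ u1 u2]; rewrite /on_arc (adjacent_before ad) //.
  by rewrite addbb.
have hu : {in s, forall u, on_arc w u v = on_arc w u (mate v)}.
  by move=> u /ms[uw uv _ _]; apply: on_arc_adjacent.
have hs : {in s &, forall x u, on_arc s x u = on_arc w x u}.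
  by move=> x u /ms[_ xv _ _] /ms[_ uv _ _]; apply: on_arc_others.
have wss := wf_others v ww.
have d1 : word_dsum phi s = dsum phi s jump (on_arc w) by apply: eq_dsum_arc.
split.
  rewrite d1 /word_dsum (perm_dsum _ _ _ pw).
  by rewrite (dsum_isolated ws jump_alternating op he hv hu).
move=> f; rewrite d1 => f0; rewrite /word_crossing_sum (perm_crossing_sum _ _ _
  _ pw).
by rewrite (crossing_sum_isolated ws jump_alternating op he hv hu f0);
  apply: eq_crossing_sum_arc.
Qed.

Lemma bigon_adjacent w u v (s := others v (others u w)) : wf w ->
  adjacent w u v -> adjacent w (mate u) (mate v) -> xing u != xing v ->
  jump v = - jump u -> bigon s jump (on_arc w) u v.
Proof.
move=> ww ad am uv jv.
have [uw vw nuv _] := ad; have [muw mvw nmuv _] := am.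
have neq a b : xing a != xing b -> a != b by apply: contraNneq => ->.
have vu : xing v != xing u by rewrite eq_sym.
have ms z : z \in s -> [/\ z \in w, xing z != xing u & xing z != xing v].
  by rewrite !mem_filter => /and3P[].
have nm x : x != mate x by rewrite eq_sym mate_neq.
have muu : before w (mate u) u = before w (mate v) v.
  have [_ _ _ ->] := ad; rewrite ?mate_neq ?neq //.
  by apply: (adjacent_before am); rewrite ?nm ?neq.
split=> //.
- by move=> z /ms[zw zu zv]; split; apply: on_arc_adjacent.
- move=> z /ms[zw zu zv]; rewrite /on_arc muu.
  by rewrite (adjacent_before ad) ?neq // (adjacent_before am) ?neq.
- have [_ _ _ h] := ad.
  have e1 : before w (mate v) u = before w (mate v) v.
    by rewrite h ?mate_neq ?neq.
  have e2 : before w (mate u) v = before w (mate v) v.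
    by apply: (adjacent_before am); rewrite ?nm ?neq.
  rewrite /on_arc muu e1 e2 (before_antisym uw vw) // -!addNb.
  by case: (before w u v); case: (before w (mate v) v).
- have [_ _ _ h] := am.
  have e1 : before w u (mate v) = before w u (mate u).
    by rewrite h ?nm ?neq.
  have e2 : before w v (mate u) = before w u (mate u).
    by rewrite (adjacent_before ad) ?mate_neq ?neq.
  rewrite /on_arc muu e1 e2 (before_antisym muw mvw) //.
  by case: (before w u (mate u)); case: (before w (mate u) (mate v));
    case: (before w (mate v) v).
Qed.

Lemma same_RII phi w u v (s := others v (others u w)) : wf w -> odd_fun phi ->
  adjacent w u v -> adjacent w (mate u) (mate v) -> xing u != xing v ->
  jump v = - jump u -> lev u = lev v -> same_sums phi s w.
Proof.
move=> ww op ad am uv jv luv.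
have [uw vw _ _] := ad.
have ms z : z \in s -> [/\ z \in w, xing z != xing u & xing z != xing v].
  by rewrite !mem_filter => /and3P[].
have b := bigon_adjacent ww ad am uv jv; rewrite -/s in b.
have wu := wf_others u ww; have wss : wf s := wf_others v wu.
have vu : v \in others u w by rewrite mem_filter vw eq_sym uv.
have pw : perm_eq w [:: u, mate u, v, mate v & s].
  by apply: perm_trans (wf_split ww uw) _; rewrite !perm_cons; apply: wf_split.
have ws := wf_perm pw ww.
have he : arc_rel [:: u, mate u, v, mate v & s] (on_arc w).
  by move=> z; rewrite -(perm_mem pw); apply: arc_rel_on_arc.
have hs : {in s &, forall x z, on_arc s x z = on_arc w x z}.
  move=> x z /ms[_ xu xv] /ms[_ zu zv].
  by rewrite /s !on_arc_others.
have lk : {in s, forall z, on_arc w u z (+) on_arc w u (mate z)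
                         = on_arc w z u (+) on_arc w z (mate u)}.
  by move=> z /ms[zw zu _]; apply: on_arc_link.
have d1 : word_dsum phi s = dsum phi s jump (on_arc w) by apply: eq_dsum_arc.
split.
  by rewrite d1 /word_dsum (perm_dsum _ _ _ pw) (dsum_bigon ws jump_alternating
    op he b).
move=> f _; rewrite /word_crossing_sum (perm_crossing_sum _ _ _ _ pw).
by rewrite (crossing_sum_bigon f ws jump_alternating op he b lk luv);
  apply: eq_crossing_sum_arc.
Qed.

(** [(u, v)] is [(a, b)] or [(b, a)]. *)
Definition is_pair (a b u v : visit) : bool :=
  (u == a) && (v == b) || (u == b) && (v == a).

Lemma is_pair_sym a b u v : is_pair b a u v = is_pair a b u v.
Proof. by rewrite /is_pair orbC. Qed.

Lemma before_swap a u v b x y (w := a ++ [:: u; v] ++ b) :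
  uniq w -> x \in w -> y \in w ->
  before (a ++ [:: v; u] ++ b) x y = before w x y (+) is_pair u v x y.
Proof.
rewrite /w cat_uniq => /and3P[_ /hasPn h uq] xw yw.
have {uq} uv : u != v by move: uq; rewrite /= inE negb_or => /andP[/andP[]].
have /negbTE ua : u \notin a by apply: h; rewrite mem_head.
have /negbTE va : v \notin a by apply: h; rewrite !inE eqxx orbT.
rewrite /before !(index_cat _ a) /=.
have na z : z \in a -> (u == z = false) * (v == z = false).
  by move=> za; split; apply/eqP => e; move: za; rewrite -e ?ua ?va.
have lt z : z \in a -> (index z a < size a)%N by rewrite index_mem.
rewrite /is_pair ![_ == u]eq_sym ![_ == v]eq_sym.
case xa: (x \in a); case ya: (y \in a).
- by rewrite !(na _ xa) addbF.
- by rewrite !(na _ xa) /= addbF !ltn_addr ?lt.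
- have ge n : (size a + n < index y a)%N = false.
    by apply/negbTE; rewrite -leqNgt ltnW // ltn_addr ?lt.
  by rewrite !(na _ ya) !andbF /= addbF !ge.
rewrite !ltn_add2l.
have [ux|ux] := eqVneq u x; have [vx|vx] := eqVneq v x;
have [uy|uy] := eqVneq u y; have [vy|vy] := eqVneq v y;
  rewrite /= ?addbF ?ltnS //; by move/eqP: uv; case; congruence.
Qed.

Lemma neq_multi (x y : visit) : xing x != xing y ->
  ((x == y = false) * (x == mate y = false) * (mate x == y = false)
  * (mate x == mate y = false) * (y == x = false) * (y == mate x = false)
  * (mate y == x = false) * (mate y == mate x = false))%type.
Proof.
move=> h; have n a b : xing a != xing b -> a == b = false.
  by move=> ab; apply/negbTE; apply: contraNneq ab => ->.
by rewrite !n // eq_sym.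
Qed.

Lemma neq_mate_multi (x : visit) :
  ((x == mate x = false) * (mate x == x = false))%type.
Proof. by rewrite eq_sym !(negbTE (mate_neq x)). Qed.

(** [w'] arises from [w] by transposing the neighbours at the three strands of
    a triangle, whose vertices are named as for [corner].  The three side
    conditions say that the edges of the triangle lie on a common side of each
    strand, as in [triangle]; the last condition excludes that exactly one of
    the three crossings is virtual. *)
Record triangle_move (w w' : code) (x y z : visit) (s : code) : Prop :=
  TriangleMove {
  tm_perm : perm_eq w [:: x, mate x, y, mate y, z, mate z & s];
  tm_xy : adjacent w x y;
  tm_xz : adjacent w (mate x) z;
  tm_yz : adjacent w (mate y) (mate z);
  tm_before : {in w &, forall u v, before w' u v = before w u v (+)
    (is_pair x y u v (+) is_pair (mate x) z u v
     (+) is_pair (mate y) (mate z) u v)};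
  tm_sidex : before w (mate x) z (+) from_left x
           = before w (mate y) (mate z) (+) from_left y;
  tm_sidez : before w x y (+) from_left x
           = before w (mate y) (mate z) (+) from_left z;
  tm_sidey : before w x y (+) from_left y = before w (mate x) z (+) from_left z;
  tm_slide : [|| [&& lev x != Virtual, lev y != Virtual & lev z != Virtual],
                 (lev x == Virtual) && (lev y == Virtual),
                 (lev x == Virtual) && (lev z == Virtual) |
                 (lev y == Virtual) && (lev z == Virtual)] }.

Lemma adjacent_antisym w u v : adjacent w u v -> before w v u = ~~ before w u v.
Proof. by case=> *; apply: before_antisym. Qed.

Lemma from_left_mate v : from_left (mate v) = ~~ from_left v.
Proof. by []. Qed.

Lemma virtual_mate v : (lev (mate v) == Virtual) = (lev v == Virtual).
Proof. by case: v => [[c []] b]. Qed.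

Lemma adjacent_block w a b c d : adjacent w a b -> adjacent w c d ->
  c \notin [:: a; b] -> d \notin [:: a; b] ->
  ((before w c b = before w c a) * (before w d a = before w c a)
  * (before w d b = before w c a) * (before w a c = ~~ before w c a)
  * (before w a d = ~~ before w c a) * (before w b c = ~~ before w c a)
  * (before w b d = ~~ before w c a))%type.
Proof.
move=> [aw bw ab h1] [cw dw cd h2].
rewrite !inE !negb_or => /andP[ca cb] /andP[da db].
have [ac bc] : a != c /\ b != c by rewrite !(eq_sym _ c).
have [ad bd] : a != d /\ b != d by rewrite !(eq_sym _ d).
have e1 : before w c b = before w c a by rewrite h1.
have e2 : before w d a = before w c a.
  by rewrite (before_antisym aw dw) // -h2 // (before_antisym aw cw).
have e3 : before w d b = before w c a by rewrite -h1 // e2.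
rewrite e1 e2 e3 (before_antisym cw aw) // (before_antisym cw bw) //.
by rewrite (before_antisym dw aw) // (before_antisym dw bw) // e1 e2 e3.
Qed.

Lemma triangle_move_y w w' x y z s :
  triangle_move w w' x y z s -> triangle_move w w' y x (mate z) s.
Proof.
case=> pw xy xz yz bf s1 s2 s3 sl; split; rewrite ?mateK //.
- by apply: perm_trans pw _; apply: perm_corner_y.
- exact: adjacent_sym.
- move=> u v uw vw; rewrite bf //; congr (_ (+) _).
  by rewrite is_pair_sym -!addbA; congr (_ (+) _); rewrite addbC.
- by rewrite (adjacent_antisym xy) from_left_mate addNb addbN s3.
- by rewrite (adjacent_antisym xy) from_left_mate addNb s2 addbN.
- rewrite virtual_mate; move: sl.
  by case: (_ == _); case: (_ == _); case: (_ == _).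
Qed.

Lemma triangle_move_z w w' x y z s :
  triangle_move w w' x y z s -> triangle_move w w' z (mate x) (mate y) s.
Proof.
case=> pw xy xz yz bf s1 s2 s3 sl; split; rewrite ?mateK //.
- by apply: perm_trans pw _; apply: perm_corner_z.
- exact: adjacent_sym.
- exact: adjacent_sym.
- move=> u v uw vw; rewrite bf //; congr (_ (+) _).
  rewrite [is_pair z _ _ _]is_pair_sym [is_pair (mate z) _ _ _]is_pair_sym.
  by rewrite [RHS]addbC addbA.
- by rewrite (adjacent_antisym yz) from_left_mate addNb addbN -s2.
- by rewrite (adjacent_antisym xz) from_left_mate addNb addbN -s3.
- by rewrite !from_left_mate (adjacent_antisym xz) (adjacent_antisym yz) !addNb
    !addbN !negbK s1.
- rewrite !virtual_mate; move: sl.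
  by case: (lev x == _); case: (lev y == _); case: (lev z == _).
Qed.

Section TriangleFacts.
Variables (w w' : code) (x y z : visit) (s : code).
Hypotheses (ww : wf w) (td : triangle_move w w' x y z s).

Let pw := tm_perm td.
Let wS := wf_perm pw ww.
Let wS1 := wf_behead2 wS.
Let wS2 := wf_behead2 wS1.

Lemma tri_mem : [/\ [/\ x \in w, y \in w & z \in w],
  [/\ mate x \in w, mate y \in w & mate z \in w] & {subset s <= w}].
Proof.
have h u : u \in [:: x, mate x, y, mate y, z, mate z & s] -> u \in w.
  by rewrite (perm_mem pw).
by split; [split|split|move=> u us]; apply: h; rewrite !inE ?eqxx ?us ?orbT.
Qed.

Lemma tri_xings : [/\ xing x != xing y, xing x != xing z, xing y != xing z &
  {in s, forall u, [/\ xing u != xing x, xing u != xing y & xing u != xing z]}].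
Proof.
have hx := wf_cons_others wS; have hy := wf_cons_others wS1.
have hz := wf_cons_others wS2.
split; rewrite 1?eq_sym.
- by apply: hx; rewrite mem_head.
- by apply: hx; rewrite !inE eqxx !orbT.
- by apply: hy; rewrite mem_head.
by move=> u us; split; [apply: hx|apply: hy|apply: hz]; rewrite ?inE us ?orbT.
Qed.

Lemma tri_neq : ((x == y = false) * (x == z = false) * (y == z = false)
  * (y == x = false) * (z == x = false) * (z == y = false)
  * (x == mate x = false) * (y == mate y = false) * (z == mate z = false)
  * (mate x == x = false) * (mate y == y = false) * (mate z == z = false)
  * (x == mate y = false) * (x == mate z = false) * (y == mate z = false)
  * (y == mate x = false) * (z == mate x = false) * (z == mate y = false)
  * (mate y == x = false) * (mate z == x = false) * (mate z == y = false)
  * (mate x == y = false) * (mate x == z = false) * (mate y == z = false)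
  * (mate x == mate y = false) * (mate x == mate z = false)
  * (mate y == mate z = false) * (mate y == mate x = false)
  * (mate z == mate x = false) * (mate z == mate y = false))%type.
Proof.
have [xy xz yz _] := tri_xings.
by rewrite !(neq_multi xy) !(neq_multi xz) !(neq_multi yz) !neq_mate_multi.
Qed.

Lemma tri_neq_s : {in s, forall u,
  ((u == x = false) * (u == y = false) * (u == z = false)
   * (u == mate x = false) * (u == mate y = false)
   * (u == mate z = false))%type}.
Proof.
have [_ _ _ h] := tri_xings.
by move=> u /h[ux uy uz]; rewrite !(neq_multi ux) !(neq_multi uy) !(neq_multi
  uz).
Qed.

(** The order of the six passages is determined by the order on each strand and
    by the order of the three strands. *)
Lemma tri_befores :
  ((before w y x = ~~ before w x y)
  * (before w z (mate x) = ~~ before w (mate x) z)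
  * (before w (mate z) (mate y) = ~~ before w (mate y) (mate z))
  * (before w (mate x) y = before w (mate x) x)
  * (before w z x = before w (mate x) x)
  * (before w z y = before w (mate x) x)
  * (before w x (mate x) = ~~ before w (mate x) x)
  * (before w y (mate x) = ~~ before w (mate x) x)
  * (before w x z = ~~ before w (mate x) x)
  * (before w y z = ~~ before w (mate x) x)
  * (before w (mate y) x = before w (mate y) y)
  * (before w (mate z) x = before w (mate y) y)
  * (before w (mate z) y = before w (mate y) y)
  * (before w y (mate y) = ~~ before w (mate y) y)
  * (before w x (mate y) = ~~ before w (mate y) y)
  * (before w x (mate z) = ~~ before w (mate y) y)
  * (before w y (mate z) = ~~ before w (mate y) y)
  * (before w (mate z) (mate x) = before w (mate z) z)
  * (before w (mate y) z = before w (mate z) z)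
  * (before w (mate y) (mate x) = before w (mate z) z)
  * (before w z (mate z) = ~~ before w (mate z) z)
  * (before w z (mate y) = ~~ before w (mate z) z)
  * (before w (mate x) (mate z) = ~~ before w (mate z) z)
  * (before w (mate x) (mate y) = ~~ before w (mate z) z))%type.
Proof.
have a1 := tm_xy td; have a2 := tm_xz td; have a3 := tm_yz td.
have b1 : ((mate x \notin [:: x; y]) * (z \notin [:: x; y]))%type.
  by rewrite !inE !tri_neq.
have b2 : ((mate y \notin [:: y; x]) * (mate z \notin [:: y; x]))%type.
  by rewrite !inE !tri_neq.
have b3 : ((mate z \notin [:: z; mate x])
           * (mate y \notin [:: z; mate x]))%type.
  by rewrite !inE !tri_neq.
have r1 := adjacent_block a1 a2 b1.1 b1.2.
have r2 := adjacent_block (adjacent_sym a1) a3 b2.1 b2.2.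
have r3 := adjacent_block (adjacent_sym a2) (adjacent_sym a3) b3.1 b3.2.
by rewrite !r1 !r2 !r3 !(adjacent_antisym a1) !(adjacent_antisym a2)
  !(adjacent_antisym a3).
Qed.

Lemma tri_on_arc_move u v : u \in w -> v \in w ->
  on_arc w' v u = on_arc w v u
    (+) (is_pair x y v u (+) is_pair (mate x) z v u
         (+) is_pair (mate y) (mate z) v u)
    (+) (is_pair x y (mate v) u (+) is_pair (mate x) z (mate v) u
         (+) is_pair (mate y) (mate z) (mate v) u)
    (+) (is_pair x y (mate v) v (+) is_pair (mate x) z (mate v) v
         (+) is_pair (mate y) (mate z) (mate v) v).
Proof.
move=> uw vw; have mv : mate v \in w by rewrite wf_mate.
rewrite /on_arc !(tm_before td) //.
set p1 := (_ (+) is_pair _ _ v u); set p2 := (_ (+) is_pair _ _ (mate v) u).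
set p3 := (_ (+) is_pair _ _ (mate v) v).
by case: p1; case: p2; case: p3; case: (before w v u);
   case: (before w (mate v) u); case: (before w (mate v) v).
Qed.

Lemma tri_corner : corner s jump (on_arc w) (on_arc w') x y z.
Proof.
have [[xw yw zw] [mxw myw mzw] sw] := tri_mem.
split.
- move=> u us; have uw := sw u us.
  rewrite tri_on_arc_move // /is_pair !(tri_neq_s us) !tri_neq !andbF /=.
  by rewrite !addbF.
- by rewrite !tri_on_arc_move // /is_pair !eqxx !tri_neq /= ?andbF ?addbF
    ?addbT; split.
- by rewrite /on_arc !tri_befores.
- case xv: (lev x == Virtual); [left|right].
    by rewrite /jump xv.
  have s3 := tm_sidey td; have sl := tm_slide td.
  rewrite /on_arc !tri_befores /jump; move: s3 sl; rewrite xv.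
  case: (lev y == _); case: (lev z == _) => //=;
  by case: (from_left y); case: (from_left z); case: (before w x y);
     case: (before w (mate x) z); case: (before w (mate x) x).
Qed.

Lemma tri_shape : triangle_shape s (on_arc w) x y z.
Proof.
have [[xw yw zw] [mxw myw mzw] sw] := tri_mem.
have [_ _ _ xs] := tri_xings.
split.
- by move=> u us; have [ux _ _] := xs u us; apply: on_arc_link => //; apply: sw.
- move=> u us; have uw := sw u us.
  have h a b : adjacent w a b -> u != a -> u != b ->
    before w a u = before w b u.
    by move=> ab ua ub; apply: (adjacent_before ab).
  rewrite /on_arc (h _ _ (tm_xy td)) ?(tri_neq_s us) //.
  rewrite (h _ _ (tm_xz td)) ?(tri_neq_s us) //.
  rewrite (h _ _ (tm_yz td)) ?(tri_neq_s us) // !tri_befores.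
  by case: (before w y u); case: (before w z u); case: (before w (mate z) u);
     case: (before w (mate x) x); case: (before w (mate y) y);
       case: (before w (mate z) z).
- rewrite /on_arc !tri_befores.
  by case: (before w (mate x) x); case: (before w (mate y) y);
    case: (before w (mate z) z).
- rewrite /on_arc !tri_befores.
  by case: (before w (mate x) x); case: (before w (mate y) y);
    case: (before w (mate z) z).
- rewrite /on_arc !tri_befores.
  by case: (before w (mate x) x); case: (before w (mate y) y);
    case: (before w (mate z) z);
   case: (before w (mate y) (mate z)).
Qed.

Lemma tri_strands : {in s, forall v,
  at_strands (on_arc w) (on_arc w') x y z v
  /\ {in s, on_arc w' v =1 on_arc w v}}.
Proof.
have [[xw yw zw] [mxw myw mzw] sw] := tri_mem.
have [_ _ _ xs] := tri_xings.
move=> v vs; have vw := sw v vs; have [vx vy vz] := xs v vs.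
have mvs : mate v \in s by rewrite wf_mate // (wf_behead2 wS2).
have eq u : u \in w -> on_arc w' v u = on_arc w v u.
  move=> uw; rewrite tri_on_arc_move // /is_pair !(tri_neq_s vs) !(tri_neq_s
    mvs) /=.
  by rewrite !addbF.
split; last by move=> u us; apply: eq; apply: sw.
have a1 := tm_xy td; have a2 := tm_xz td; have a3 := tm_yz td.
by split; split; try exact: eq; apply: on_arc_adjacent.
Qed.

End TriangleFacts.

Lemma tri_relP w w' x y z s : wf w -> triangle_move w w' x y z s ->
  triangle_rel s jump (on_arc w) (on_arc w') x y z.
Proof.
move=> ww td; split.
- exact: tri_corner.
- exact: (tri_corner ww (triangle_move_y td)).
- exact: (tri_corner ww (triangle_move_z td)).
- exact: tri_strands.
Qed.

Lemma same_RIII phi w w' x y z s :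
  wf w -> wf w' -> perm_eq w w' -> odd_fun phi ->
  triangle_move w w' x y z s -> same_sums phi w w'.
Proof.
move=> ww ww' pww op td.
have pw := tm_perm td; have wS := wf_perm pw ww.
have he : arc_rel w (on_arc w) by apply: arc_rel_on_arc.
have he' : arc_rel w (on_arc w').
  by move=> v; rewrite (perm_mem pww); apply: arc_rel_on_arc.
have heS : arc_rel [:: x, mate x, y, mate y, z, mate z & s] (on_arc w).
  by move=> v; rewrite -(perm_mem pw); apply: he.
have heS' : arc_rel [:: x, mate x, y, mate y, z, mate z & s] (on_arc w').
  by move=> v; rewrite -(perm_mem pw); apply: he'.
have fj := jump_alternating.
have t := tri_relP ww td; have ty := tri_relP ww (triangle_move_y td).
have tz := tri_relP ww (triangle_move_z td).
split.
  rewrite /word_dsum -(perm_dsum _ _ _ pww) !(perm_dsum _ _ _ pw).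
  exact: dsum_triangle.
move=> f _; apply: eq_crossing_sum => // v vw.
rewrite {2}/crossing_term -(perm_arcsum _ _ _ pww) -(perm_dsmooth _ _ _ _ pww).
rewrite -/(crossing_term _ _ _ _ _ _).
have hx := crossing_term_corner f pw ww fj op he he' t (tri_shape ww td).
have hy := crossing_term_corner f (tm_perm (triangle_move_y td)) ww fj op he
  he' ty
  (tri_shape ww (triangle_move_y td)).
have hz := crossing_term_corner f (tm_perm (triangle_move_z td)) ww fj op he
  he' tz
  (tri_shape ww (triangle_move_z td)).
have := vw; rewrite (perm_mem pw).
rewrite -[_ :: _]/([:: x; mate x] ++ [:: y; mate y] ++ [:: z; mate z] ++ s).
rewrite !mem_cat => /or4P[/hx|/hy|/hz|vs] //.
rewrite /crossing_term !(perm_dsmooth _ _ _ _ pw).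
rewrite (dsmooth_triangle _ wS fj heS heS' vs t) !(perm_arcsum _ _ _ pw).
have vS : v \in [:: x, mate x, y, mate y, z, mate z & s].
  by rewrite -(perm_mem pw).
by have [->|->] := arcsum_triangle wS fj heS heS' t vS; rewrite ?mul0r.
Qed.

(** The pair [p] is [q], possibly in the opposite order. *)
Definition same_ends (p q : visit * visit) : Prop := p = q \/ p = (q.2, q.1).

(** Six passages on three strands, closed under [mate], with two distinct
    crossings on each strand: any two strands meet exactly once. *)
Lemma triangle_match (p q r : visit * visit) :
  uniq [:: p.1; p.2; q.1; q.2; r.1; r.2] ->
  {in [:: p.1; p.2; q.1; q.2; r.1; r.2], forall v,
     mate v \in [:: p.1; p.2; q.1; q.2; r.1; r.2]} ->
  xing p.1 != xing p.2 -> xing q.1 != xing q.2 -> xing r.1 != xing r.2 ->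
  mate p.1 \in [:: q.1; q.2] ->
  exists z, same_ends (mate p.1, z) q /\ same_ends (mate p.2, mate z) r.
Proof.
case: p q r => [p1 p2] [q1 q2] [r1 r2] /= uq cl xp xq xr mp.
have [z zq] : exists z, same_ends (mate p1, z) (q1, q2).
  by move: mp; rewrite !inE => /orP[]/eqP ->; [exists q2; left|exists q1;
    right].
exists z; split=> //.
have pe : perm_eq [:: p1; p2; mate p1; z; r1; r2] [:: p1; p2; q1; q2; r1; r2].
  rewrite !perm_cons.
  by case: zq => [[-> ->]|[-> ->]] //=; apply/permP => P /=; clear; ring.
have uq' : uniq [:: p1; p2; mate p1; z; r1; r2] by rewrite (perm_uniq pe).
have cl' v : v \in [:: p1; p2; mate p1; z; r1; r2] ->
    mate v \in [:: p1; p2; mate p1; z; r1; r2].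
  by rewrite !(perm_mem pe); apply: cl.
have xz : xing p1 != xing z.
  case: zq => [[e1 e2]|[e1 e2]]; rewrite -(xing_mate p1) e1 e2 //.
  by rewrite eq_sym.
have c1 := cl' p2; have c2 := cl' z; have c3 := cl' r1.
have mp2 : mate p2 \in [:: r1; r2].
  move: c1; rewrite !inE eqxx !orbT => /(_ isT).
  case/or4P => [/eqP e|/eqP e|/eqP e|/or3P[/eqP e|->|->]]; rewrite ?orbT //;
    exfalso.
  - by move: xp; rewrite -e xing_mate eqxx.
  - by move: (mate_neq p2); rewrite e eqxx.
  - by move: uq'; rewrite -[p1]mateK -e !mateK /= !inE
      !(eqxx, orbT, orTb) /= ?andbF.
  move: c3; rewrite !inE eqxx !orbT => /(_ isT).
  case/or4P => [/eqP e3|/eqP e3|/eqP e3|/or3P[/eqP e3|/eqP e3|/eqP e3]].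
  - by move: uq'; rewrite -e3 mateK /= !inE
      !(eqxx, orbT, orTb) /= ?andbF.
  - by move: uq'; rewrite -e -e3 mateK /= !inE
      !(eqxx, orbT, orTb) /= ?andbF.
  - by move: uq'; rewrite -[r1]mateK e3 mateK /= !inE
      !(eqxx, orbT, orTb) /= ?andbF.
  - by move: uq'; rewrite -[r1]mateK e3 -e mateK /= !inE
      !(eqxx, orbT, orTb) /= ?andbF.
  - by move: (mate_neq r1); rewrite e3 eqxx.
  by move: xr; rewrite -e3 xing_mate eqxx.
have mz : mate z \in [:: r1; r2].
  move: c2; rewrite !inE eqxx !orbT => /(_ isT).
  case/or4P => [/eqP e|/eqP e|/eqP e|/or3P[/eqP e|->|->]]; rewrite ?orbT //;
    exfalso.
  - by move: xz; rewrite -e xing_mate eqxx.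
  - move: mp2; rewrite -e mateK !inE => /orP[]/eqP e2;
    by move: uq'; rewrite e2 /= !inE
      !(eqxx, orbT, orTb) /= ?andbF.
  - by move: uq'; rewrite -[z]mateK e mateK /= !inE
      !(eqxx, orbT, orTb) /= ?andbF.
  by move: (mate_neq z); rewrite e eqxx.
have nz : mate p2 != mate z.
  rewrite (inj_eq (inv_inj mateK)); apply: contraTneq uq' => ->.
  by rewrite /= !inE
      !(eqxx, orbT, orTb) /= ?andbF.
move: mp2 mz nz; rewrite !inE => /orP[]/eqP -> /orP[]/eqP ->; rewrite ?eqxx //.
  by left.
by right.
Qed.

(** The strand through the neighbours [u] and [v], in either order; [F] is
    the list of the first passages of the three strands of a triangle. *)
Definition strand (w : code) (F : seq visit) (u v : visit) : Prop :=
  [/\ adjacent w u v,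
      (mate u \in F) (+) from_left u = (mate v \in F) (+) from_left v,
      (u \in F) = before w u v & (v \in F) = before w v u].

Lemma strand_same_ends w F q u v :
  same_ends (u, v) q -> strand w F q.1 q.2 -> strand w F u v.
Proof.
case: q => q1 q2 [[-> ->]|[-> ->]] //= [ad s1 s2 s3].
by split => //; apply: adjacent_sym.
Qed.

Lemma is_pair_same_ends q u v : same_ends (u, v) q ->
  is_pair u v =2 is_pair q.1 q.2.
Proof. by case: q => q1 q2 [[-> ->]|[-> ->]] x y //=; apply: is_pair_sym. Qed.

Lemma strand_at_same_ends q u v l : same_ends (u, v) q ->
  strand_at l (u, v) = strand_at l q.
Proof. by case: q => q1 q2 [[-> ->]|[-> ->]] //; rewrite /strand_at andbC. Qed.

Lemma perm_same_ends q u v : same_ends (u, v) q ->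
  perm_eq [:: u; v] [:: q.1; q.2].
Proof.
case: q => q1 q2 [[-> ->]|[-> ->]] //=.
by apply/permP => P /=; clear; ring.
Qed.

Lemma triangle_move_intro w w' x y z s F :
  perm_eq w [:: x, mate x, y, mate y, z, mate z & s] ->
  strand w F x y -> strand w F (mate x) z ->
  strand w F (mate y) (mate z) ->
  {in w &, forall u v, before w' u v = before w u v (+)
    (is_pair x y u v (+) is_pair (mate x) z u v
     (+) is_pair (mate y) (mate z) u v)} ->
  slidable [:: (x, y); (mate x, z); (mate y, mate z)] ->
  triangle_move w w' x y z s.
Proof.
move=> pw [a1 s1 f1 g1] [a2 s2 f2 g2] [a3 s3 f3 g3] bf sl; split=> //.
- by rewrite -f2 s1 f3.
- rewrite -f1; move: s2; rewrite mateK from_left_mate addbN g3.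
  by rewrite (adjacent_antisym a3) addNb => /negb_inj.
- move: s3; rewrite !mateK !from_left_mate !addbN => /negb_inj.
  rewrite g1 g2 (adjacent_antisym a1) (adjacent_antisym a2) !addNb.
  by move/negb_inj.
move: sl; rewrite /slidable /strand_at /= /lev /= -/(lev x) -/(lev y) -/(lev z).
by case: (lev x); case: (lev y); case: (lev z).
Qed.

Lemma before_infix a u v b :
  uniq (a ++ [:: u; v] ++ b) -> before (a ++ [:: u; v] ++ b) u v.
Proof.
move=> uq; rewrite /before; move: uq;
  rewrite cat_uniq => /and3P[_ /hasPn h /= /and3P[]].
rewrite inE negb_or => /andP[/negbTE uv _] _ _.
rewrite !(index_cat _ a) (negbTE (h v _)) ?(negbTE (h u _)) ?inE ?eqxx ?orbT //.
by rewrite /= !eqxx uv ltn_add2l.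
Qed.

Lemma triangle_move_RIII a b c d (p q r : visit * visit)
  (w := a ++ [:: p.1; p.2] ++ b ++ [:: q.1; q.2] ++ c ++ [:: r.1; r.2] ++ d)
  (w' := a ++ [:: p.2; p.1] ++ b ++ [:: q.2; q.1] ++ c ++ [:: r.2; r.1] ++ d) :
  wf w -> triangle [:: p; q; r] -> slidable [:: p; q; r] ->
  exists x y z, triangle_move w w' x y z (a ++ b ++ c ++ d).
Proof.
move=> ww /and3P[/allP cl /allP xs /allP sides] sl.
have uq := wf_uniq ww.
have pw : perm_eq w ([:: p.1; p.2; q.1; q.2; r.1; r.2] ++ a ++ b ++ c ++ d).
  by apply/permP => P; rewrite /w /= !count_cat /= !count_cat /= !count_cat /=;
    clear; ring.
set L := [:: p.1; p.2; q.1; q.2; r.1; r.2] in pw.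
have uL : uniq L by move: uq; rewrite (perm_uniq pw) cat_uniq => /andP[].
have eL : L =i [:: p.1; q.1; r.1] ++ [:: p.2; q.2; r.2].
  by apply: perm_mem; apply/permP => P /=; clear; ring.
have clL : {in L, forall v, mate v \in L}.
  by move=> v; rewrite !eL; apply: cl.
have xp : xing p.1 != xing p.2 by apply: xs; rewrite mem_head.
have xq : xing q.1 != xing q.2 by apply: xs; rewrite !inE eqxx !orbT.
have xr : xing r.1 != xing r.2 by apply: xs; rewrite !inE eqxx !orbT.
set F := [:: p.1; q.1; r.1].
have notF : [/\ p.2 \notin F, q.2 \notin F & r.2 \notin F].
  have : uniq (F ++ [:: p.2; q.2; r.2]).
    by apply: etrans uL; apply: perm_uniq; apply/permP => P /=; clear; ring.
  rewrite cat_uniq => /and3P[_ /hasPn h _].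
  by split; apply: h; rewrite !inE eqxx ?orbT.
have side u v : (u, v) \in [:: p; q; r] ->
    (mate u \in F) (+) from_left u = (mate v \in F) (+) from_left v.
  by move=> uv; have /eqP := sides _ uv.
have wq : w = (a ++ [:: p.1; p.2] ++ b)
              ++ [:: q.1; q.2] ++ c ++ [:: r.1; r.2] ++ d.
  by rewrite /w -!catA.
have wr : w = (a ++ [:: p.1; p.2] ++ b ++ [:: q.1; q.2] ++ c)
              ++ [:: r.1; r.2] ++ d.
  by rewrite /w -!catA.
have ok u v a' b' : w = a' ++ [:: u; v] ++ b' -> (u, v) \in [:: p; q; r] ->
    u \in F -> v \notin F -> strand w F u v.
  move=> ew uv uF vF; have ad : adjacent w u v.
    by rewrite ew; apply: adjacent_infix; rewrite -ew.
  have bw : before w u v by rewrite ew; apply: before_infix; rewrite -ew.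
  by split; rewrite ?uF ?(negbTE vF) ?bw ?(adjacent_antisym ad) ?bw //;
    apply: side.
have [np nq nr] := notF.
have okp : strand w F p.1 p.2.
  by apply: (ok _ _ a) => //; rewrite ?inE -?surjective_pairing ?eqxx.
have okq : strand w F q.1 q.2.
  by apply: ok wq _ _ _ => //; rewrite ?inE -?surjective_pairing ?eqxx ?orbT.
have okr : strand w F r.1 r.2.
  by apply: ok wr _ _ _ => //; rewrite ?inE -?surjective_pairing ?eqxx ?orbT.
have bf : {in w &, forall u v, before w' u v = before w u v (+)
    (is_pair p.1 p.2 u v (+) is_pair q.1 q.2 u v (+) is_pair r.1 r.2 u v)}.
  pose w1 := a ++ [:: p.2; p.1] ++ b ++ [:: q.1; q.2] ++ c
    ++ [:: r.1; r.2] ++ d.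
  pose w2 := a ++ [:: p.2; p.1] ++ b ++ [:: q.2; q.1] ++ c
    ++ [:: r.1; r.2] ++ d.
  have sw e f (u v : visit) :
      perm_eq (e ++ [:: u; v] ++ f) (e ++ [:: v; u] ++ f).
    by apply/permP => P; rewrite !count_cat /=; ring.
  have p1 : perm_eq w w1 by apply: sw.
  have p2 : perm_eq w1 w2.
    have := sw (a ++ [:: p.2; p.1] ++ b) (c ++ [:: r.1; r.2] ++ d) q.1 q.2.
    by rewrite -!catA.
  have p12 := perm_trans p1 p2.
  move=> u v uw vw.
  have -> : before w' u v = before w2 u v (+) is_pair r.1 r.2 u v.
    have := @before_swap (a ++ [:: p.2; p.1] ++ b ++ [:: q.2; q.1] ++ c)
      r.1 r.2 d u v.
    by rewrite -!catA => -> //; rewrite -?(perm_uniq p12) -?(perm_mem p12).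
  have -> : before w2 u v = before w1 u v (+) is_pair q.1 q.2 u v.
    have := @before_swap (a ++ [:: p.2; p.1] ++ b)
      q.1 q.2 (c ++ [:: r.1; r.2] ++ d) u v.
    by rewrite -!catA => -> //; rewrite -?(perm_uniq p1) -?(perm_mem p1).
  have -> : before w1 u v = before w u v (+) is_pair p.1 p.2 u v.
    exact: before_swap.
  by rewrite !addbA.
have : mate p.1 \in L by apply: clL; rewrite mem_head.
rewrite !inE (negbTE (mate_neq _)) /=.
case/orP => [/eqP e|]; first by move: xp; rewrite -e xing_mate eqxx.
rewrite orbA => /orP[mp|mp].
  have [z [zq zr]] : exists z,
      same_ends (mate p.1, z) q /\ same_ends (mate p.2, mate z) r.
    by apply: triangle_match => //; rewrite !inE.
  exists p.1, p.2, z; apply: (@triangle_move_intro _ _ _ _ _ _ F) => //.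
  - apply: perm_trans pw _.
    rewrite -[L]/([:: p.1; p.2] ++ [:: q.1; q.2] ++ [:: r.1; r.2]) -!catA.
    apply: (@perm_trans _ ([:: p.1; p.2] ++ [:: mate p.1; z]
      ++ [:: mate p.2; mate z] ++ a ++ b ++ c ++ d)).
      rewrite perm_cat2l perm_cat ?perm_cat // perm_sym; exact: perm_same_ends.
    by apply/permP => P /=; clear; ring.
  - exact: strand_same_ends zq okq.
  - exact: strand_same_ends zr okr.
  - by move=> u v uw vw; rewrite bf // (is_pair_same_ends zq)
      (is_pair_same_ends zr).
  - move: sl; rewrite /slidable /= -!surjective_pairing.
    by rewrite !(strand_at_same_ends _ zq) !(strand_at_same_ends _ zr).
have [z [zr zq]] : exists z,
    same_ends (mate p.1, z) r /\ same_ends (mate p.2, mate z) q.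
  have e : perm_eq [:: p.1; p.2; r.1; r.2; q.1; q.2] L.
    by apply/permP => P /=; clear; ring.
  apply: triangle_match => //; rewrite ?inE // ?(perm_uniq e) //.
  by move=> v; rewrite !(perm_mem e); apply: clL.
exists p.1, p.2, z; apply: (@triangle_move_intro _ _ _ _ _ _ F) => //.
- apply: perm_trans pw _.
  rewrite -[L]/([:: p.1; p.2] ++ [:: q.1; q.2] ++ [:: r.1; r.2]) -!catA.
  apply: (@perm_trans _ ([:: p.1; p.2] ++ [:: mate p.2; mate z]
    ++ [:: mate p.1; z] ++ a ++ b ++ c ++ d)).
    rewrite perm_cat2l perm_cat ?perm_cat // perm_sym; exact: perm_same_ends.
  by apply/permP => P /=; clear; ring.
- exact: strand_same_ends zr okr.
- exact: strand_same_ends zq okq.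
- move=> u v uw vw; rewrite bf // (is_pair_same_ends zq) (is_pair_same_ends zr).
  by rewrite addbAC.
move: sl; rewrite /slidable /= -!surjective_pairing.
rewrite !(strand_at_same_ends _ zq) !(strand_at_same_ends _ zr) !orbF.
by rewrite ![strand_at _ q || _]orbC.
Qed.

Lemma same_sums_sym phi w w' : same_sums phi w w' -> same_sums phi w' w.
Proof. by case=> h1 h2; split=> // f f0; rewrite h2 // h1. Qed.

Lemma same_sums_trans phi w1 w2 w3 :
  same_sums phi w1 w2 -> same_sums phi w2 w3 -> same_sums phi w1 w3.
Proof.
case=> h1 h2 [h3 h4]; split; first by rewrite h1.
by move=> f f0; rewrite h2 // h4 // -h1.
Qed.

(** * Invariance and the crossing change *)

Lemma same_rename phi f w : wf w -> injective f ->
  same_sums phi w (map (rename f) w).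
Proof.
move=> ww fi; set g := rename f.
have gm : {in w, forall x, g (mate x) = mate (g x)} by [].
have gx : {in w &, forall u v, (xing (g u) == xing (g v)) = (xing u == xing v)}.
  by move=> u v _ _; apply: (inj_eq fi).
have gi := wf_map_inj ww gm gx.
have ge : {in w &, forall v u, xing u != xing v ->
    on_arc (map g w) (g v) (g u) = on_arc w v u}.
  by move=> v u vw uw _; apply: on_arc_map.
have gj : {in w, forall v, jump (g v) = jump v} by [].
split; first by rewrite /word_dsum (dsum_map phi gx gj ge).
move=> h _; rewrite /word_crossing_sum /crossing_sum big_map big_seq_cond
  [RHS]big_seq_cond.
apply: eq_bigr => v /andP[vw _]; rewrite /crossing_term.
by rewrite (dsmooth_map phi ww vw gm gx gj ge) (arcsum_map vw gx gj ge).
Qed.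

Lemma others_infix2 a b v : wf (a ++ [:: v; mate v] ++ b) ->
  others v (a ++ [:: v; mate v] ++ b) = a ++ b.
Proof.
move=> ww; have pw : perm_eq (a ++ [:: v; mate v] ++ b) [:: v, mate v & a ++ b].
  by rewrite perm_catCA.
have h := wf_cons_others (wf_perm pw ww).
rewrite /others !filter_cat /= xing_mate eqxx /= -filter_cat.
by rewrite -/(others v _) others_id.
Qed.

Lemma others_pairs a b c u v (m : code) :
  wf (a ++ [:: u; v] ++ b ++ m ++ c) ->
  m = [:: mate u; mate v] \/ m = [:: mate v; mate u] -> xing u != xing v ->
  others v (others u (a ++ [:: u; v] ++ b ++ m ++ c)) = a ++ b ++ c.
Proof.
move=> ww hm uv.
have pw : perm_eq (a ++ [:: u; v] ++ b ++ m ++ c)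
                  [:: u, mate u, v, mate v & a ++ b ++ c].
  by apply/permP => P; case: hm => ->; rewrite /= !count_cat /= !count_cat /=;
    ring.
have w1 := wf_perm pw ww.
have hu := wf_cons_others w1; have hv := wf_cons_others (wf_behead2 w1).
have vu : xing v != xing u by rewrite eq_sym.
have em : [seq x <- [seq x <- m | xing x != xing u] | xing x != xing v] = [::].
  by case: hm => ->; rewrite /= !xing_mate !eqxx ?vu /= !xing_mate ?vu /=
    ?xing_mate !eqxx.
rewrite /others !filter_cat em /= eqxx vu /= eqxx /= -!filter_cat.
have e1 : others u (a ++ b ++ c) = a ++ b ++ c.
  by apply: others_id => x xs; apply: hu; rewrite !inE xs !orbT.
by rewrite -/(others u _) e1; apply: others_id.
Qed.

Lemma same_RII_word phi a b c x y l t (u := (x, l, t)) (v := (y, l, ~~ t))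
  (m : code) (w' := a ++ [:: u; v] ++ b ++ m ++ c) :
  m = [:: mate u; mate v] \/ m = [:: mate v; mate u] ->
  odd_fun phi -> wf w' -> same_sums phi (a ++ b ++ c) w'.
Proof.
move=> hm op ww.
have ad : adjacent w' u v by apply: adjacent_infix (wf_uniq ww).
have am : adjacent w' (mate u) (mate v).
  have ew m' : m = m' -> w' = (a ++ [:: u; v] ++ b) ++ m' ++ c.
    by move=> <-; rewrite /w' -!catA.
  case: hm => e; last apply: adjacent_sym; rewrite (ew _ e);
  by apply: adjacent_infix; rewrite -e -(ew _ (erefl _)) wf_uniq.
have [uw vw uv _] := ad; have [muw mvw _ _] := am.
have xuv : xing u != xing v.
  apply/eqP => e; have [e'|e'] := wf_xing ww uw vw (esym e).
    by rewrite e' eqxx in uv.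
  (* otherwise [v = mate u], and [mate u] would occur twice in [w'] *)
  have := wf_count ww muw; rewrite /w'; case: hm => ->; rewrite e' mateK;
  by rewrite !count_cat /= !eqxx; clear; lia.
rewrite -(others_pairs ww hm xuv).
apply: same_RII => //.
by rewrite /jump /lev /from_left /=; case: (l) => //=; case: (t).
Qed.

Lemma same_move phi p p' : odd_fun phi -> move p p' -> wf p.1 -> wf p'.1 ->
  same_sums phi p.1 p'.1.
Proof.
move=> op [] /=.
- by move=> f w s fi ww _; apply: same_rename.
- move=> k w s s' _ _ ww _; apply: same_perm => //.
    by rewrite perm_sym perm_rot.
  by move=> v u vw uw; rewrite on_arc_rot.
- move=> a b v s _ ww; rewrite -(others_infix2 ww); apply: same_RI => //.
  exact: adjacent_infix (wf_uniq ww).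
- move=> a b c x y l t s _ ww.
  exact: (@same_RII_word phi a b c x y l t _ (or_introl erefl) op ww).
- move=> a b c x y l t s _ ww.
  exact: (@same_RII_word phi a b c x y l t _ (or_intror erefl) op ww).
move=> a b c d p1 q r s tr sl ww ww'.
have [x [y [z td]]] := triangle_move_RIII ww tr sl.
apply: same_RIII td => //.
by apply/permP => P; rewrite /= !count_cat /= !count_cat /= !count_cat /=; ring.
Qed.

Lemma vdiagram_wf (D : vdiagram) : wf D.
Proof. by case: D => w s /= /andP[]. Qed.

Lemma same_vequiv phi (D E : vdiagram) : odd_fun phi -> vequiv D E ->
  same_sums phi D E.
Proof.
move=> op; elim=> {D E} [D E m|D|D E _ h|D1 D2 D3 _ h1 _ h2].
- by apply: (same_move op m); apply: vdiagram_wf.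
- by [].
- exact: same_sums_sym.
- exact: same_sums_trans h1 h2.
Qed.

(** At the crossing of [v] the overpassage becomes [mate v], which negates the
    jump and the arc sum; all other terms are unchanged. *)
Lemma crossing_sum_switch phi f w v :
  wf w -> odd_fun phi -> v \in w -> lev v = Over ->
  word_crossing_sum phi f w - word_crossing_sum phi f (map (switch (xing v)) w)
  = jump v * (f (arcsum w jump (on_arc w) v)
                `|dsmooth phi w jump (on_arc w) v|
              + f (- arcsum w jump (on_arc w) v)
                `|dsmooth phi w jump (on_arc w) v|).
Proof.
move=> ww op vw vo; set g := switch (xing v).
have mw : mate v \in w by rewrite wf_mate.
have gm : {in w, forall x, g (mate x) = mate (g x)}.
  by move=> x _; rewrite mate_switch.
have gx : {in w &, forall u v, (xing (g u) == xing (g v)) = (xing u == xing v)}.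
  by move=> a b _ _; rewrite !xing_switch.
have gi := wf_map_inj ww gm gx.
have ge : {in w &, forall v u, xing u != xing v ->
    on_arc (map g w) (g v) (g u) = on_arc w v u}.
  by move=> a b aw bw _; apply: on_arc_map.
have gj : {in w, forall v, jump (g v) = jump v}.
  move=> a _; rewrite /g /switch; case: ifP => // _.
  by case: a => [[k []] b].
have -> : word_crossing_sum phi f (map g w)
        = \sum_(u <- w | lev (g u) == Over)
            crossing_term phi f w jump (on_arc w) u.
  rewrite /word_crossing_sum /crossing_sum big_map big_seq_cond
    [RHS]big_seq_cond.
  apply: eq_bigr => u /andP[uw _]; rewrite /crossing_term.
  by rewrite (dsmooth_map phi ww uw gm gx gj ge) (arcsum_map uw gx gj ge) gj.
have pw := wf_split ww vw.
rewrite /word_crossing_sum /crossing_sum !(perm_big _ pw) /= !big_cons.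
have -> : lev (g v) == Over = false.
  by rewrite /g /switch eqxx /lev /= -/(lev v) vo.
have -> : lev (g (mate v)) == Over.
  by rewrite /g /switch xing_mate eqxx /lev /= -/(lev v) vo.
have -> : lev (mate v) == Over = false by rewrite /lev /= -/(lev v) vo.
rewrite vo eqxx.
have -> : \sum_(u <- others v w | lev (g u) == Over)
            crossing_term phi f w jump (on_arc w) u
        = \sum_(u <- others v w | lev u == Over)
            crossing_term phi f w jump (on_arc w) u.
  rewrite big_seq_cond [RHS]big_seq_cond; apply: eq_bigl => u.
  case us: (u \in others v w) => //=; move: us;
    rewrite mem_filter => /andP[uv _].
  by rewrite /g /switch (negbTE uv).
have he := arc_rel_on_arc ww; have fj := jump_alternating.
rewrite /crossing_term (arcsum_mate ww fj he vw) (dsmooth_mate ww fj op he vw).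
rewrite normrN jump_mate.
move: (\sum_(_ <- _ | _) _) (f _ _) (f _ _) (jump v) => a b c d; ring.
Qed.

Lemma not_cosmetic (D : vdiagram) phi (f : int -> int -> int) v : odd_fun phi ->
  v \in dcode D -> lev v = Over -> f 0 `|word_dsum phi D| = 0 ->
  f (arcsum D jump (on_arc D) v) `|dsmooth phi D jump (on_arc D) v|
  + f (- arcsum D jump (on_arc D) v) `|dsmooth phi D jump (on_arc D) v| <> 0 ->
  ~ cosmetic D (xing v).
Proof.
move=> op vD vo f0 hf cos; have ww := vdiagram_wf D.
have [_ h] := same_sums_sym (same_vequiv op cos).
have := crossing_sum_switch f ww op vD vo; rewrite -(h f f0) subrr => /esym/eqP.
rewrite mulf_eq0 /jump vo /= => /orP[|/eqP //].
by case: ifP.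
Qed.

Theorem corollary5p4 (D : vdiagram)
    (h : forall c : nat, c \in classical D ->
       ind D c <> 0 \/
       exists n : nat, [/\ (0 < n)%N,
         dwrithe n (smoothing c D) <> dwrithe n D &
         dwrithe n (smoothing c D) <> - dwrithe n D]) :
  ~ (exists2 c : nat, c \in classical D & cosmetic D c).
Proof.
have ww := vdiagram_wf D.
move=> [c cD]; have [v + ec] := mapP cD.
rewrite mem_filter => /andP[/eqP vo vD].
have [hi|[n [_ h1 h2]]] := h c cD.
  rewrite ec in hi *; rewrite ind_arcsum // in hi.
  set A := arcsum _ _ _ v in hi.
  (* [f] ignores the dwrithes, so that any odd function may replace [spike 1] *)
  apply: (@not_cosmetic _ (spike 1) (fun i _ => (i == A)%:Z)) => //.
  - exact: odd_spike.
  - by case: eqP => // e; move: hi; rewrite -e oppr0.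
  rewrite -/A eqxx; case: eqP => //.
rewrite ec in h1 h2 *.
apply: (@not_cosmetic _ (spike n)
  (fun _ m => (m == `|dsmooth (spike n) D jump (on_arc D) v|)%:Z)) => //.
- exact: odd_spike.
- case: eqP => // e; exfalso; move: e.
  have ws : wf (smoothing (xing v) D) by rewrite -ec; apply: smoothing_wf.
  rewrite -dsum_smoothing // /word_dsum !dsum_dwrithe //.
  rewrite !mulr2n.
  move: (dwrithe n D) (dwrithe n (smoothing _ D)) h1 h2 => a b; clear; lia.
by rewrite eqxx.
Qed.
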